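(* Let $C$ be a computad with invertible generators. For every $n\in\mathbb N$ and every element $i\in I_{n+1}(C)$ of its invertibility set, the cell $\mathrm{fwd}_{n+1}(i)$ of the weak $\omega$-category $K(C)$ generated by $C$ is (coinductively) invertible.
   Context: GLOBULAR SETS. For $n\in\mathbb N\cup\{-1,\omega\}$, an $n$-globular set $X$ consists of sets $X_k$ (of $k$-cells) for natural numbers $k\le n$ and functions $s_k,t_k\colon X_{k+1}\to X_k$ with $s_ks_{k+1}=s_kt_{k+1}$ and $t_ks_{k+1}=t_kt_{k+1}$. They form a presheaf category $\mathrm{gSet}_n$ (terminal for $n=-1$); $\mathrm{gSet}=\mathrm{gSet}_\omega$; $\mathrm{tr}_m$ denotes truncation. An $n$-globular set is regarded as a globular set without cells above dimension $n$. $\mathrm{Par}_n(X)$ is the set of pairs $(a,b)$ of parallel $n$-cells ($n=0$, or $a,b$ have the same source and the same target); $(a,b)^{\mathrm{op}}=(b,a)$. $\mathbb D^n$ is the representable globular set on $n$ and $\mathbb S^{n-1}\subset\mathbb D^n$ is obtained by removing its unique $n$-cell. PASTING DIAGRAMS. The suspension $\Sigma X$ has $(\Sigma X)_0=\{\sigma,\tau\}$, $(\Sigma X)_{n+1}=X_n$, every $1$-cell having source $\sigma$ and target $\tau$; its chosen $0$-cells are $\sigma,\tau$. For globular sets with two chosen $0$-cells (first and last), the wedge sum $X\vee Y$ glues the last $0$-cell of $X$ to the first of $Y$; the empty wedge is $\mathbb D^0$. Batanin trees are defined inductively: $\mathrm{br}[B_1,\dots,B_n]$ is a tree for every finite list of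 trees. $\dim\mathrm{br}[B_1,\dots,B_n]=\max_i(\dim B_i+1)$ ($0$ for the empty list); $\partial_0B=\mathrm{br}[\,]$, $\partial_{k+1}\mathrm{br}[B_1,\dots,B_n]=\mathrm{br}[\partial_kB_1,\dots,\partial_kB_n]$. $\mathrm{Pos}(\mathrm{br}[B_1,\dots,B_n])=\Sigma\mathrm{Pos}(B_1)\vee\dots\vee\Sigma\mathrm{Pos}(B_n)$. The maps $\sigma_k^B,\tau_k^B\colon\mathrm{Pos}(\partial_kB)\to\mathrm{Pos}(B)$ are: $\sigma_0^B,\tau_0^B$ pick the first and last chosen $0$-cell, and $\sigma_{k+1}^{\mathrm{br}[B_1,\dots,B_n]}=\Sigma\sigma_k^{B_1}\vee\dots\vee\Sigma\sigma_k^{B_n}$, similarly for $\tau$. Let $D_0=\mathrm{br}[\,]$, $D_{n+1}=\mathrm{br}[D_n]$, so $\mathrm{Pos}(D_n)\cong\mathbb D^n$ with top cell $d_n$; let $Q_1=\mathrm{br}[D_0,D_0]$, $Q_{n+1}=\mathrm{br}[Q_n]$, so $\mathrm{Pos}(Q_n)$ consists of two $n$-cells $p_n,q_n$ with $t_{n-1}p_n=s_{n-1}q_n$ and represents pairs of $n$-cells composable along an $(n-1)$-cell. COMPUTADS WITH INVERTIBLE GENERATORS. By recursion on $n$ one defines: a category $\mathrm{iComp}_n$ with truncation functors; functors $\mathrm{Cell}_n\colon\mathrm{iComp}_n\to\mathrm{gSet}_n$ and $\mathrm{Cptd}_n\colon\mathrm{gSet}_n\to\mathrm{iComp}_n$ with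 an adjunction $\mathrm{Cptd}_n\dashv\mathrm{Cell}_n$, compatible with truncation; for each tree $B$ a set $\mathrm{Full}_n(B)\subseteq\mathrm{Par}_n(\mathrm{Cell}_n\mathrm{Cptd}_n(\mathrm{tr}_n\mathrm{Pos}(B)))$ of full spheres; a functor $I_n\colon\mathrm{iComp}_n\to\mathrm{Set}$ (invertibility set); and natural functions $\mathrm{fwd}_n,\mathrm{linv}_n,\mathrm{rinv}_n\colon I_n(C)\to\mathrm{Cell}_n(C)_n$. Base: $\mathrm{iComp}_{-1}$ is terminal; $\mathrm{iComp}_0=\mathrm{Set}$, $\mathrm{Cell}_0$ and $\mathrm{Cptd}_0$ are identities, $\mathrm{gen}_0$ is the identity (a $0$-computad is its set $V_0$ of generators), $\mathrm{Full}_0(B)=\{(\sigma_0^B,\tau_0^B)\}$, $I_0(C)=\emptyset$. Successor: an $(n+1)$-computad is a tuple $C=(C_n,V_{n+1}^C,U_{n+1}^C,\phi_{n+1}^C,\psi_{n+1}^C)$ with $C_n\in\mathrm{iComp}_n$ (its truncation), sets $V_{n+1}^C$ (ordinary generators) and $U_{n+1}^C$ (invertible generators), and attaching functions $\phi_{n+1}^C\colon V_{n+1}^C\to\mathrm{Par}_n(\mathrm{Cell}_n(C_n))$, $\psi_{n+1}^C\colon U_{n+1}^C\to\mathrm{Par}_n(\mathrm{Cell}_n(C_n))$. The set $I_{n+1}(C)$ is the disjoint union of elements $\mathrm{igen}(u)$ ($u\in U_{n+1}^C$), $\mathrm{lunit}(i)$ and $\mathrm{runit}(i)$ ($i\in I_n(C_n)$).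 The function $\mathrm{ibdry}\colon I_{n+1}(C)\to\mathrm{Par}_n(\mathrm{Cell}_n(C_n))$ is $\mathrm{ibdry}(\mathrm{igen}(u))=\psi_{n+1}^C(u)$, $\mathrm{ibdry}(\mathrm{lunit}(i))=(\mathrm{linv}_n(i)*\mathrm{fwd}_n(i),\ \mathrm{id}_n(t_{n-1}\mathrm{fwd}_n(i)))$, $\mathrm{ibdry}(\mathrm{runit}(i))=(\mathrm{fwd}_n(i)*\mathrm{rinv}_n(i),\ \mathrm{id}_n(s_{n-1}\mathrm{fwd}_n(i)))$, with $*$ and $\mathrm{id}$ defined below. For $X\in\mathrm{gSet}_{n+1}$, $\mathrm{Cptd}_{n+1}(X)$ has truncation $\mathrm{Cptd}_n(\mathrm{tr}_nX)$, $V_{n+1}=X_{n+1}$, $U_{n+1}=\emptyset$, and $\phi_{n+1}(x)$ is the image of $(s_nx,t_nx)$ under the unit $\mathrm{tr}_nX\to\mathrm{Cell}_n\mathrm{Cptd}_n(\mathrm{tr}_nX)$. $\mathrm{Cell}_{n+1}(C)$ agrees with $\mathrm{Cell}_n(C_n)$ in dimensions $\le n$. Its set of $(n+1)$-cells with boundary function $\mathrm{bdry}=(s_n,t_n)$, and morphisms of $(n+1)$-computads into $C$, are defined mutually inductively (induction-recursion). The $(n+1)$-cells are freely: $\mathrm{gen}(v)$ for $v\in V_{n+1}^C$, with boundary $\phi_{n+1}^C(v)$; for each $i\in I_{n+1}(C)$, $\mathrm{fwd}_{n+1}(i)$ with boundary $\mathrm{ibdry}(i)$, and $\mathrm{linv}_{n+1}(i)$,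 $\mathrm{rinv}_{n+1}(i)$ with boundary $\mathrm{ibdry}(i)^{\mathrm{op}}$; and $\mathrm{coh}_{B,A}[f]$ for every tree $B$ with $\dim B\le n+1$, $A\in\mathrm{Full}_n(B)$ and morphism $f\colon\mathrm{Cptd}_{n+1}(\mathrm{Pos}(B))\to C$, with boundary $\mathrm{Par}_n(\mathrm{Cell}_n(f_n))(A)$. A morphism $f\colon D\to C$ is a triple of a morphism $f_n\colon D_n\to C_n$ and functions $f_V\colon V_{n+1}^D\to\mathrm{Cell}_{n+1}(C)_{n+1}$, $f_U\colon U_{n+1}^D\to I_{n+1}(C)$ with $\mathrm{bdry}\circ f_V=\mathrm{Par}_n(\mathrm{Cell}_n(f_n))\circ\phi_{n+1}^D$ and $\mathrm{ibdry}\circ f_U=\mathrm{Par}_n(\mathrm{Cell}_n(f_n))\circ\psi_{n+1}^D$. Action of $f$: $I_{n+1}(f)$ sends $\mathrm{igen}(u)\mapsto f_U(u)$, $\mathrm{lunit}(i)\mapsto\mathrm{lunit}(I_n(f_n)(i))$, $\mathrm{runit}(i)\mapsto\mathrm{runit}(I_n(f_n)(i))$; $\mathrm{Cell}_{n+1}(f)$ is $\mathrm{Cell}_n(f_n)$ below dimension $n+1$ and sends $\mathrm{gen}(v)\mapsto f_V(v)$, $\mathrm{fwd}(i)\mapsto\mathrm{fwd}(I_{n+1}(f)(i))$ and likewise for $\mathrm{linv},\mathrm{rinv}$, $\mathrm{coh}_{B,A}[g]\mapsto\mathrm{coh}_{B,A}[f\circ g]$. Composition: $(f\circ g)_n=f_n\circ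 g_n$, $(f\circ g)_V=\mathrm{Cell}_{n+1}(f)\circ g_V$, $(f\circ g)_U=I_{n+1}(f)\circ g_U$; identity $(\mathrm{id},\mathrm{gen},\mathrm{igen})$. For $h\colon X\to Y$ in $\mathrm{gSet}_{n+1}$, $\mathrm{Cptd}_{n+1}(h)=(\mathrm{Cptd}_n(\mathrm{tr}_nh),\mathrm{gen}\circ h_{n+1},!)$. The unit of $\mathrm{Cptd}_{n+1}\dashv\mathrm{Cell}_{n+1}$ sends cells to the corresponding generators; the counit $\mathrm{Cptd}_{n+1}\mathrm{Cell}_{n+1}(C)\to C$ sends each generator to the cell it is. Support of an $(n+1)$-cell (a set of $(n+1)$-dimensional generators): $\mathrm{supp}(\mathrm{gen}(v))=\{v\}$; $\mathrm{supp}$ of $\mathrm{fwd}(i),\mathrm{linv}(i),\mathrm{rinv}(i)$ is $\{u\}$ if $i=\mathrm{igen}(u)$ and $\emptyset$ otherwise; $\mathrm{supp}(\mathrm{coh}_{B,A}[f])=\bigcup_{p\in\mathrm{Pos}(B)_{n+1}}\mathrm{supp}(f_V(p))$. A pair $(a,b)\in\mathrm{Par}_{n+1}(\mathrm{Cell}_{n+1}\mathrm{Cptd}_{n+1}(\mathrm{tr}_{n+1}\mathrm{Pos}(B)))$ is in $\mathrm{Full}_{n+1}(B)$ iff $\mathrm{supp}(a)$ and $\mathrm{supp}(b)$ are the images of $\mathrm{Pos}(\partial_{n+1}B)_{n+1}$ under $\sigma_{n+1}^B$ and $\tau_{n+1}^B$ respectively, and $\mathrm{bdry}(a)=\mathrm{bdry}(b)\in\mathrm{Full}_n(B)$.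 Identities and composites: for an $n$-cell $c$ of $C$, $\mathrm{id}_{n+1}(c)=\mathrm{coh}_{D_n,(\mathrm{gen}(d_n),\mathrm{gen}(d_n))}[\hat c]$, where $\hat c\colon\mathrm{Cptd}_{n+1}(\mathrm{Pos}(D_n))\to C$ corresponds to $c$; for $(n+1)$-cells $a,b$ with $t_na=s_nb$, $a*b=\mathrm{coh}_{Q_{n+1},(\mathrm{gen}(s_np_{n+1}),\mathrm{gen}(t_nq_{n+1}))}[\widehat{(a,b)}]$, where $\widehat{(a,b)}\colon\mathrm{Cptd}_{n+1}(\mathrm{Pos}(Q_{n+1}))\to C$ sends $p_{n+1}\mapsto a$, $q_{n+1}\mapsto b$. Limit: $\mathrm{iComp}=\mathrm{iComp}_\omega=\lim_n\mathrm{iComp}_n$ along truncations, so a computad $C$ is a compatible sequence $(C_n)_n$, and $\mathrm{Cptd}\dashv\mathrm{Cell}$ between $\mathrm{gSet}$ and $\mathrm{iComp}$ is induced levelwise. For a computad $C$, $I_{n+1}(C)$ means $I_{n+1}(C_{n+1})$. WEAK $\omega$-CATEGORIES. $T=\mathrm{Cell}\circ\mathrm{Cptd}$ is the monad on $\mathrm{gSet}$ induced by $\mathrm{Cptd}\dashv\mathrm{Cell}$ and $\mathrm{Cat}_\omega$ is its category of algebras (weak $\omega$-categories). $K\colon\mathrm{iComp}\to\mathrm{Cat}_\omega$ is the comparison functor, $K(C)=(\mathrm{Cell}(C),\mathrm{Cell}(\varepsilon_C))$ with $\varepsilon$ the counit. In a weak $\omega$-category $(X,\gamma\colon TX\to X)$,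 the identity of $x\in X_n$ is $\mathrm{id}(x)=\gamma(T(\hat x)(\mathrm{id}_{n+1}(\mathrm{gen}(d_n))))$ with $\hat x\colon\mathrm{Pos}(D_n)\to X$ classifying $x$, and for $x,y\in X_n$ with $t_{n-1}x=s_{n-1}y$, $x*y=\gamma(T(\widehat{(x,y)})(\mathrm{gen}(p_n)*\mathrm{gen}(q_n)))$ with $\widehat{(x,y)}\colon\mathrm{Pos}(Q_n)\to X$ classifying $(x,y)$ (composition in diagrammatic order). In $K(C)$ these agree with the operations on cells of $C$ above. INVERTIBILITY. For a weak $\omega$-category $X$, the family of sets $\mathrm{Inv}_{X,f}$ of invertibility structures, indexed by positive-dimensional cells $f$ of $X$, is defined coinductively: an element of $\mathrm{Inv}_{X,f}$ for $f\colon x\to y$ consists of cells $f_l\colon y\to x$ and $f_r\colon y\to x$, cells $f_L\colon f_l*f\to\mathrm{id}(y)$ and $f_R\colon f*f_r\to\mathrm{id}(x)$, and elements of $\mathrm{Inv}_{X,f_L}$ and $\mathrm{Inv}_{X,f_R}$. That is, $\mathrm{Inv}_X$ is the terminal coalgebra of the endofunctor $G_X(W)_f=\bigl(\coprod_{f_l}\coprod_{f_L\colon f_l*f\to\mathrm{id}(y)}W_{f_L}\bigr)\times\bigl(\coprod_{f_r}\coprod_{f_R\colon f*f_r\to\mathrm{id}(x)}W_{f_R}\bigr)$ on families of sets indexed by positive-dimensional cells. A cell $f$ is invertible when $\mathrm{Inv}_{X,f}\neq\emptyset$. *)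

(* Defs.v *)
From Stdlib Require Import ssreflect ssrfun List PeanoNat FunctionalExtensionality ProofIrrelevance.
Import ListNotations.

Set Implicit Arguments.
Unset Strict Implicit.
Unset Printing Implicit Defensive.

(* Sets are rendered as types. Proof irrelevance (hence uniqueness of identity
   proofs) and functional extensionality are used freely. *)

Record gSet : Type := GSet {
  cells :> nat -> Type;
  src : forall k, cells (S k) -> cells k;
  tgt : forall k, cells (S k) -> cells k;
  src_glob : forall k (x : cells (S (S k))), src (src x) = src (tgt x);
  tgt_glob : forall k (x : cells (S (S k))), tgt (src x) = tgt (tgt x) }.

Record gHom (X Y : gSet) : Type := GHom {
  hcell :> forall k, X k -> Y k;
  hcell_src : forall k (x : X (S k)), src (hcell x) = hcell (src x);
  hcell_tgt : forall k (x : X (S k)), tgt (hcell x) = hcell (tgt x) }.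

Arguments hcell {X Y} g {k} x.

Definition gHom_comp (X Y Z : gSet) (g : gHom Y Z) (f : gHom X Y) : gHom X Z.
Proof.
refine (@GHom X Z (fun k x => g k (f k x)) _ _) => k x.
- by rewrite !hcell_src.
- by rewrite !hcell_tgt.
Defined.

Definition parallel (X : gSet) (n : nat) : X n -> X n -> Prop :=
  match n with
  | 0 => fun _ _ => True
  | S m => fun a b => src a = src b /\ tgt a = tgt b
  end.

Lemma parallel_bdry (X : gSet) (n : nat) (x : X (S n)) : parallel (src x) (tgt x).
Proof.
case: n x => [|n] x //=; split; [exact: src_glob | exact: tgt_glob].
Qed.

Lemma parallel_map (X Y : gSet) (h : gHom X Y) (n : nat) (a b : X n) :
  parallel a b -> parallel (h n a) (h n b).
Proof. by case: n a b => [|n] a b //= [e e']; rewrite !hcell_src !hcell_tgt e e'. Qed.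

(** The categories of [n]-globular sets are built by recursion on [n], in the
   shape in which the categories of [n]-computads are: an [(n+1)]-globular set
   is an [n]-globular set with a set of [(n+1)]-cells and a function sending
   each of them to its boundary, a pair of parallel [n]-cells. *)

Record gStage : Type := GStage {
  gob :> Type;
  gcell : gob -> Type;
  gparallel : forall X : gob, gcell X -> gcell X -> Prop;
  gparallel_refl : forall (X : gob) (a : gcell X), gparallel a a;
  gparallel_sym : forall (X : gob) (a b : gcell X), gparallel a b -> gparallel b a;
  gparallel_trans : forall (X : gob) (a b c : gcell X),
    gparallel a b -> gparallel b c -> gparallel a c;
  ghom : gob -> gob -> Type;
  gid : forall X, ghom X X;
  gcomp : forall X Y Z, ghom Y Z -> ghom X Y -> ghom X Z;
  gcomp_id_l : forall X Y (f : ghom X Y), gcomp (gid Y) f = f;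
  gcomp_id_r : forall X Y (f : ghom X Y), gcomp f (gid X) = f;
  gcomp_assoc : forall X Y Z W (h : ghom Z W) (g : ghom Y Z) (f : ghom X Y),
    gcomp h (gcomp g f) = gcomp (gcomp h g) f;
  gmap : forall X Y, ghom X Y -> gcell X -> gcell Y;
  gmap_id : forall X (a : gcell X), gmap (gid X) a = a;
  gmap_comp : forall X Y Z (g : ghom Y Z) (f : ghom X Y) (a : gcell X),
    gmap (gcomp g f) a = gmap g (gmap f a);
  gmap_parallel : forall X Y (f : ghom X Y) (a b : gcell X),
    gparallel a b -> gparallel (gmap f a) (gmap f b) }.

Section Par.
Variable G : gStage.

Record Par (X : G) : Type := MkPar {
  pfst : gcell X;
  psnd : gcell X;
  ppar : gparallel pfst psnd }.

Lemma Par_eq (X : G) (p q : Par X) : pfst p = pfst q -> psnd p = psnd q -> p = q.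
Proof.
case: p => [a b h]; case: q => [a' b' h'] /= e e'; subst a' b'.
by rewrite (proof_irrelevance _ h h').
Qed.

Definition Par_op (X : G) (p : Par X) : Par X := MkPar (gparallel_sym (ppar p)).

Definition Par_map (X Y : G) (f : ghom X Y) (p : Par X) : Par Y :=
  MkPar (gmap_parallel f (ppar p)).

Lemma Par_map_id (X : G) (p : Par X) : Par_map (gid X) p = p.
Proof. by apply: Par_eq; rewrite /= gmap_id. Qed.

Lemma Par_map_comp (X Y Z : G) (g : ghom Y Z) (f : ghom X Y) (p : Par X) :
  Par_map (gcomp g f) p = Par_map g (Par_map f p).
Proof. by apply: Par_eq; rewrite /= gmap_comp. Qed.

Lemma Par_map_op (X Y : G) (f : ghom X Y) (p : Par X) :
  Par_map f (Par_op p) = Par_op (Par_map f p).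
Proof. exact: Par_eq. Qed.

End Par.

Definition gStage0 : gStage.
Proof.
refine (@GStage Type (fun X => X) (fun _ _ _ => True) _ _ _
         (fun X Y => X -> Y) (fun _ x => x) (fun _ _ _ g f x => g (f x))
         _ _ _ (fun _ _ f x => f x) _ _ _); by [].
Defined.

Section GStageSucc.
Variable G : gStage.

Record sgob : Type := SGob {
  sg_base : G;
  sg_top : Type;
  sg_bdry : sg_top -> Par sg_base }.

Record sghom (X Y : sgob) : Type := SGHom {
  sgh_base : ghom (sg_base X) (sg_base Y);
  sgh_top : sg_top X -> sg_top Y;
  sgh_bdry : forall x, sg_bdry (sgh_top x) = Par_map sgh_base (sg_bdry x) }.

Lemma sghom_eq (X Y : sgob) (f g : sghom X Y) :
  sgh_base f = sgh_base g -> (forall x, sgh_top f x = sgh_top g x) -> f = g.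
Proof.
case: f => [f0 f1 ff]; case: g => [g0 g1 gg] /= e e'; subst g0.
have e1 : f1 = g1 by exact: functional_extensionality.
subst g1; by rewrite (proof_irrelevance _ ff gg).
Qed.

Definition sgid (X : sgob) : sghom X X.
Proof.
refine (@SGHom X X (gid _) (fun x => x) _) => x.
by rewrite Par_map_id.
Defined.

Definition sgcomp (X Y Z : sgob) (g : sghom Y Z) (f : sghom X Y) : sghom X Z.
Proof.
refine (@SGHom X Z (gcomp (sgh_base g) (sgh_base f)) (fun x => sgh_top g (sgh_top f x)) _) => x.
by rewrite Par_map_comp !sgh_bdry.
Defined.

Definition gStageS : gStage.
Proof.
refine (@GStage sgob sg_top (fun X a b => sg_bdry a = sg_bdry b) _ _ _
         sghom sgid sgcomp _ _ _ sgh_top _ _ _).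
- by [].
- by [].
- by move=> X a b c -> ->.
- by move=> X Y f; apply: sghom_eq => //=; rewrite gcomp_id_l.
- by move=> X Y f; apply: sghom_eq => //=; rewrite gcomp_id_r.
- by move=> X Y Z W h g f; apply: sghom_eq => //=; rewrite gcomp_assoc.
- by [].
- by [].
- by move=> X Y f a b e; rewrite !sgh_bdry e.
Defined.

End GStageSucc.

Fixpoint gSetn (n : nat) : gStage :=
  match n with
  | 0 => gStage0
  | S m => gStageS (gSetn m)
  end.

Definition bdry (n : nat) (X : gSetn (S n)) (x : gcell X) : Par (sg_base X) := sg_bdry x.

(** The [n]-truncation of [X] comes with a map identifying its [n]-cells with
   those of [X], since the two types agree by computation only for concrete [n]. *)

Record trunc_data (X : gSet) (n : nat) : Type := TruncData {
  td_ob : gSetn n;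
  td_cell : X n -> gcell td_ob;
  td_par : forall a b : X n, parallel a b -> gparallel (td_cell a) (td_cell b) }.

Fixpoint trunc (X : gSet) (n : nat) : trunc_data X n :=
  match n return trunc_data X n with
  | 0 => @TruncData X 0 (X 0) (fun x => x) (fun _ _ _ => I)
  | S m =>
    let T := trunc X m in
    let bd (x : X (S m)) := MkPar (td_par T (parallel_bdry x)) in
    @TruncData X (S m) (SGob bd) (fun x => x)
      (fun a b e => Par_eq (p := bd a) (q := bd b)
         (f_equal (@td_cell _ _ T) (proj1 e)) (f_equal (@td_cell _ _ T) (proj2 e)))
  end.

Definition tr (n : nat) (X : gSet) : gSetn n := td_ob (trunc X n).

Definition tcell (n : nat) (X : gSet) (x : X n) : gcell (tr n X) := td_cell (trunc X n) x.

Definition tpar (n : nat) (X : gSet) (a b : X n) (e : parallel a b) : Par (tr n X) :=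
  MkPar (td_par (trunc X n) e).

Lemma tpar_eq (n : nat) (X : gSet) (a b a' b' : X n) (e : parallel a b) (e' : parallel a' b') :
  a = a' -> b = b' -> tpar e = tpar e'.
Proof. by move=> ea eb; apply: Par_eq; rewrite /= ?ea ?eb. Qed.

Lemma tcell_ind (n : nat) (X : gSet) (P : gcell (tr n X) -> Prop) :
  (forall x : X n, P (tcell x)) -> forall c, P c.
Proof. by case: n P => [|n] P H c; exact: H. Qed.

Record trmap_data (X Y : gSet) (h : gHom X Y) (n : nat) : Type := TrMapData {
  tm_hom : ghom (tr n X) (tr n Y);
  tm_cell : forall x : X n, gmap tm_hom (tcell x) = tcell (h n x) }.

Lemma trmap_bdry (X Y : gSet) (h : gHom X Y) (n : nat) (F : trmap_data h n) (x : X (S n)) :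
  sg_bdry (s := tr (S n) Y) (h (S n) x) = Par_map (tm_hom F) (sg_bdry (s := tr (S n) X) x).
Proof. by apply: Par_eq; rewrite [RHS](tm_cell F) /= ?hcell_src ?hcell_tgt. Qed.

Fixpoint trmap_aux (X Y : gSet) (h : gHom X Y) (n : nat) : trmap_data h n :=
  match n return trmap_data h n with
  | 0 => @TrMapData X Y h 0 (fun x => h 0 x) (fun x => eq_refl)
  | S m =>
    let F := trmap_aux h m in
    @TrMapData X Y h (S m)
      (@SGHom (gSetn m) (tr (S m) X) (tr (S m) Y) (tm_hom F) (fun x => h (S m) x) (trmap_bdry F))
      (fun x => eq_refl)
  end.

Definition trmap (n : nat) (X Y : gSet) (h : gHom X Y) : ghom (tr n X) (tr n Y) :=
  tm_hom (trmap_aux h n).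

Lemma trmap_cell (n : nat) (X Y : gSet) (h : gHom X Y) (x : X n) :
  gmap (trmap n h) (tcell x) = tcell (h n x).
Proof. exact: tm_cell. Qed.

Record bgSet : Type := BGSet {
  bg :> gSet;
  bfirst : bg 0;
  blast : bg 0 }.

Record bgHom (X Y : bgSet) : Type := BGHom {
  bhom :> gHom X Y;
  bhom_first : bhom 0 (bfirst X) = bfirst Y;
  bhom_last : bhom 0 (blast X) = blast Y }.

Definition point_cells (k : nat) : Type := match k with 0 => unit | S _ => Empty_set end.

Definition point_gSet : gSet.
Proof.
unshelve refine (@GSet point_cells (fun k x => match x with end) (fun k x => match x with end) _ _).
all: by move=> k [].
Defined.

Definition point : bgSet := @BGSet point_gSet tt tt.

(** The wedge sum of the suspension of [X] and of [Y]. Since the last 0-cell of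
   the suspension is glued to the first one of [Y], the 0-cells of the wedge are
   the first 0-cell [None] of the suspension and those of [Y]. *)
Section SuspWedge.
Variables (X : gSet) (Y : bgSet).

Definition sw_cells (k : nat) : Type :=
  match k with 0 => option (Y 0) | S j => (X j + Y (S j))%type end.

Definition sw_src (k : nat) : sw_cells (S k) -> sw_cells k :=
  match k with
  | 0 => fun x => match x with inl _ => None | inr y => Some (src y) end
  | S j => fun x => match x with inl x' => inl (src x') | inr y => inr (src y) end
  end.

Definition sw_tgt (k : nat) : sw_cells (S k) -> sw_cells k :=
  match k with
  | 0 => fun x => match x with inl _ => Some (bfirst Y) | inr y => Some (tgt y) end
  | S j => fun x => match x with inl x' => inl (tgt x') | inr y => inr (tgt y) end
  end.

Definition sw_gSet : gSet.
Proof.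
unshelve refine (@GSet sw_cells sw_src sw_tgt _ _).
all: by case=> [|k] [x|y] //=; rewrite ?src_glob ?tgt_glob.
Defined.

Definition susp_wedge : bgSet := @BGSet sw_gSet None (Some (blast Y)).

End SuspWedge.

Definition sw_map (X X' : gSet) (Y Y' : bgSet) (f : gHom X X') (g : bgHom Y Y') :
  bgHom (susp_wedge X Y) (susp_wedge X' Y').
Proof.
unshelve refine (@BGHom (susp_wedge X Y) (susp_wedge X' Y')
  (@GHom (sw_gSet X Y) (sw_gSet X' Y')
    (fun k => match k return sw_cells X Y k -> sw_cells X' Y' k with
      | 0 => fun x => match x with None => None | Some y => Some (g 0 y) end
      | S j => fun x => match x with inl x' => inl (f j x') | inr y => inr (g (S j) y) end
      end) _ _) _ _).
- by case=> [|k] [x|y] //=; rewrite hcell_src.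
- by case=> [|k] [x|y] //=; rewrite ?hcell_tgt ?bhom_first.
- by [].
- by rewrite /= bhom_last.
Defined.

Definition point_id : bgHom point point.
Proof.
unshelve refine (@BGHom point point (@GHom point_gSet point_gSet (fun _ x => x) _ _) _ _).
all: by [].
Defined.

Inductive tree : Type := br : list tree -> tree.

Fixpoint dim (B : tree) : nat :=
  let: br l := B in fold_right Nat.max 0 (map (fun B' => S (dim B')) l).

Fixpoint bd (k : nat) (B : tree) : tree :=
  match k with
  | 0 => br []
  | S j => let: br l := B in br (map (bd j) l)
  end.

Fixpoint Pos (B : tree) : bgSet :=
  let: br l := B in
  (fix wedge (l : list tree) : bgSet :=
     match l with
     | [] => point
     | B' :: l' => susp_wedge (Pos B') (wedge l')
     end) l.

Definition pick (X : gSet) (x : X 0) : gHom point X.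
Proof.
unshelve refine (@GHom point X (fun k => match k return point k -> X k with
  | 0 => fun _ => x | S _ => fun e => match e with end end) _ _).
all: by move=> k [].
Defined.

Fixpoint sigma (k : nat) (B : tree) {struct k} : gHom (Pos (bd k B)) (Pos B) :=
  match k return gHom (Pos (bd k B)) (Pos B) with
  | 0 => pick (bfirst (Pos B))
  | S j =>
    match B return gHom (Pos (bd (S j) B)) (Pos B) with
    | br l =>
      bhom ((fix wedge (l : list tree) : bgHom (Pos (br (map (bd j) l))) (Pos (br l)) :=
         match l return bgHom (Pos (br (map (bd j) l))) (Pos (br l)) with
         | [] => point_id
         | B' :: l' => sw_map (sigma j B') (wedge l')
         end) l)
    end
  end.

Fixpoint tau (k : nat) (B : tree) {struct k} : gHom (Pos (bd k B)) (Pos B) :=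
  match k return gHom (Pos (bd k B)) (Pos B) with
  | 0 => pick (blast (Pos B))
  | S j =>
    match B return gHom (Pos (bd (S j) B)) (Pos B) with
    | br l =>
      bhom ((fix wedge (l : list tree) : bgHom (Pos (br (map (bd j) l))) (Pos (br l)) :=
         match l return bgHom (Pos (br (map (bd j) l))) (Pos (br l)) with
         | [] => point_id
         | B' :: l' => sw_map (tau j B') (wedge l')
         end) l)
    end
  end.

Fixpoint D (n : nat) : tree :=
  match n with 0 => br [] | S m => br [D m] end.

(** The tree of two composable [(n+1)]-cells, written with an index shifted by
   one: [Q n] is the tree usually called Q_{n+1}. *)
Fixpoint Q (n : nat) : tree :=
  match n with 0 => br [D 0; D 0] | S m => br [Q m] end.

Lemma dim_D (n : nat) : dim (D n) = n.
Proof. elim: n => // n IH; rewrite -[in RHS]IH; exact: (Nat.max_0_r (S _)). Qed.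

Lemma dim_Q (n : nat) : dim (Q n) = S n.
Proof. elim: n => // n IH; rewrite -[in RHS]IH; exact: (Nat.max_0_r (S _)). Qed.

Fixpoint dcell (n : nat) : Pos (D n) n :=
  match n with 0 => tt | S m => inl (dcell m) end.

Fixpoint pcell (n : nat) : Pos (Q n) (S n) :=
  match n with 0 => inl tt | S m => inl (pcell m) end.

Fixpoint qcell (n : nat) : Pos (Q n) (S n) :=
  match n with 0 => inr (inl tt) | S m => inl (qcell m) end.

Lemma pq_glue (n : nat) : tgt (pcell n) = src (qcell n).
Proof. by elim: n => [|n IH] //; rewrite /= IH. Qed.

Lemma pq_parallel (n : nat) : parallel (src (pcell n)) (tgt (qcell n)).
Proof.
have := parallel_bdry (pcell n); have := parallel_bdry (qcell n); rewrite -pq_glue.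
move: (src _) (tgt _) (tgt _) => a b c.
by case: n a b c => [|n] a b c //= [-> ->] [-> ->].
Qed.

Lemma D_empty (n : nat) : Pos (D n) (S n) -> False.
Proof. by elim: n => [|n IH] [] //= x; exact: IH. Qed.

Lemma Q_empty (n : nat) : Pos (Q n) (S (S n)) -> False.
Proof. elim: n => [|n IH] [] //=; by [case | move=> x; exact: IH]. Qed.

Fixpoint src0 (X : gSet) (k : nat) : X (S k) -> X 0 :=
  match k with 0 => fun x => src x | S j => fun x => src0 (src x) end.

Fixpoint tgt0 (X : gSet) (k : nat) : X (S k) -> X 0 :=
  match k with 0 => fun x => tgt x | S j => fun x => tgt0 (tgt x) end.

Lemma src0_src (X : gSet) (k : nat) (x : X (S (S k))) : src0 (src x) = src0 x.
Proof. by []. Qed.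

Lemma src0_tgt (X : gSet) (k : nat) (x : X (S (S k))) : src0 (tgt x) = src0 x.
Proof. by case: k x => [|k] x /=; rewrite src_glob. Qed.

Lemma tgt0_src (X : gSet) (k : nat) (x : X (S (S k))) : tgt0 (src x) = tgt0 x.
Proof. by case: k x => [|k] x /=; rewrite tgt_glob. Qed.

Lemma tgt0_tgt (X : gSet) (k : nat) (x : X (S (S k))) : tgt0 (tgt x) = tgt0 x.
Proof. by []. Qed.

Section Between.
Variables (X : gSet) (a b : X 0).

Definition between_cells (k : nat) : Type := {x : X (S k) | src0 x = a /\ tgt0 x = b}.

Definition between : gSet.
Proof.
unshelve refine (@GSet between_cells
  (fun k x => exist _ (src (proj1_sig x)) _) (fun k x => exist _ (tgt (proj1_sig x)) _) _ _).
- by rewrite src0_src tgt0_src; exact: (proj2_sig x).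
- by rewrite src0_tgt tgt0_tgt; exact: (proj2_sig x).
- by move=> k x; apply: subset_eq_compat; rewrite /= src_glob.
- by move=> k x; apply: subset_eq_compat; rewrite /= tgt_glob.
Defined.

End Between.

(** Maps out of a suspension amount to maps into the globular set of cells
   between two 0-cells. *)
Definition sw_out (X : gSet) (Y : bgSet) (Z : gSet) (a : Z 0) (g : gHom Y Z)
  (f : gHom X (between a (g 0 (bfirst Y)))) : gHom (susp_wedge X Y) Z.
Proof.
unshelve refine (@GHom (susp_wedge X Y) Z
  (fun k => match k return sw_cells X Y k -> Z k with
    | 0 => fun x => match x with None => a | Some y => g 0 y end
    | S j => fun x => match x with inl x' => proj1_sig (f j x') | inr y => g (S j) y end
    end) _ _).
- case=> [|k] [x|y] /=; rewrite ?hcell_src //; first exact: (proj1 (proj2_sig (f 0 x))).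
  by rewrite -(hcell_src f).
- case=> [|k] [x|y] /=; rewrite ?hcell_tgt //; first exact: (proj2 (proj2_sig (f 0 x))).
  by rewrite -(hcell_tgt f).
Defined.

Fixpoint classify (n : nat) (Z : gSet) : Z n -> gHom (Pos (D n)) Z :=
  match n return Z n -> gHom (Pos (D n)) Z with
  | 0 => fun z => pick z
  | S m => fun z =>
      @sw_out (Pos (D m)) point Z (src0 z) (pick (tgt0 z))
        (classify (Z := between (src0 z) (tgt0 z)) (exist _ z (conj eq_refl eq_refl)))
  end.

Lemma classify_dcell (n : nat) (Z : gSet) (z : Z n) : classify z n (dcell n) = z.
Proof. elim: n Z z => [|n IH] Z z //=; by rewrite IH. Qed.

Lemma src0_glue (Z : gSet) (n : nat) (x y : Z (S (S n))) :
  tgt x = src y -> src0 y = src0 x /\ tgt0 y = tgt0 x.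
Proof. by move=> e; rewrite -src0_src -e src0_tgt -(tgt0_src y) -e tgt0_tgt. Qed.

Fixpoint classify2 (n : nat) (Z : gSet) :
  forall x y : Z (S n), tgt x = src y -> gHom (Pos (Q n)) Z :=
  match n return forall x y : Z (S n), tgt x = src y -> gHom (Pos (Q n)) Z with
  | 0 => fun x y e =>
      @sw_out point (Pos (D 1)) Z (src x) (classify y) (@pick (between _ _) (exist _ x (conj eq_refl e)))
  | S m => fun x y e =>
      @sw_out (Pos (Q m)) point Z (src0 x) (pick (tgt0 x))
        (@classify2 m (between (src0 x) (tgt0 x))
           (exist _ x (conj eq_refl eq_refl)) (exist _ y (src0_glue e))
           (subset_eq_compat _ _ _ _ _ _ e))
  end.

Lemma classify2_pcell (n : nat) (Z : gSet) (x y : Z (S n)) (e : tgt x = src y) :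
  classify2 e (S n) (pcell n) = x.
Proof. elim: n Z x y e => [|n IH] Z x y e //=; by rewrite IH. Qed.

Lemma classify2_qcell (n : nat) (Z : gSet) (x y : Z (S n)) (e : tgt x = src y) :
  classify2 e (S n) (qcell n) = y.
Proof. elim: n Z x y e => [|n IH] Z x y e //=; by rewrite IH. Qed.

(** A labelling of the cells of [Z] by [lo] such that, below dimension [n], the
   source of every cell is labelled [false] and its target [true] lets one map
   the cells of [Z] of dimension less than [n] to the iterated sources and
   targets of a given family of parallel [n]-cells of [X]. *)

Definition labelling (Z : gSet) (n : nat) (lo : forall k, Z k -> bool) : Prop :=
  forall k (x : Z (S k)), k < n -> lo k (src x) = false /\ lo k (tgt x) = true.

Definition Par_pick (G : gStage) (X : G) (p : Par X) (b : bool) : gcell X :=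
  if b then psnd p else pfst p.

Lemma Par_pick_parallel (G : gStage) (X : G) (p : Par X) (b b' : bool) :
  gparallel (Par_pick p b) (Par_pick p b').
Proof.
case: b b' => [] [] /=;
  by [exact: gparallel_refl | exact: ppar | exact: (gparallel_sym (ppar p))].
Qed.

Record fill_data (n : nat) (Z : gSet) (J : Type) (dec : Z n -> J) (X : gSetn n)
  (c : J -> gcell X) : Type := FillData {
  fd_hom : ghom (tr n Z) X;
  fd_cell : forall z : Z n, gmap fd_hom (tcell z) = c (dec z) }.

Lemma labelling_lt (Z : gSet) (n : nat) (lo : forall k, Z k -> bool) :
  labelling (S n) lo -> labelling n lo.
Proof. move=> H k x Hk; apply: H; exact: Nat.lt_lt_succ_r. Qed.

Lemma fill_bdry (n : nat) (Z : gSet) (lo : forall k, Z k -> bool) (H : labelling (S n) lo)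
  (J : Type) (j0 : J) (dec : Z (S n) -> J) (X : gSetn (S n)) (c : J -> gcell X)
  (Hc : forall j j', gparallel (c j) (c j'))
  (F : fill_data (lo n) (Par_pick (bdry (c j0)))) (z : Z (S n)) :
  sg_bdry (c (dec z)) = Par_map (fd_hom F) (sg_bdry (s := tr (S n) Z) z).
Proof.
have [Hs Ht] := H n z (Nat.lt_succ_diag_r n).
rewrite (Hc (dec z) j0 : sg_bdry _ = sg_bdry _).
apply: Par_eq; [have := fd_cell F (src z) | have := fd_cell F (tgt z)].
- by rewrite Hs => /= <-.
- by rewrite Ht => /= <-.
Qed.

Fixpoint fill_aux (n : nat) (Z : gSet) (lo : forall k, Z k -> bool) (H : labelling n lo)
  (J : Type) (j0 : J) (dec : Z n -> J) (X : gSetn n) (c : J -> gcell X)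
  (Hc : forall j j', gparallel (c j) (c j')) {struct n} : fill_data dec c :=
  match n return labelling n lo -> forall (dec : Z n -> J) (X : gSetn n) (c : J -> gcell X),
    (forall j j', gparallel (c j) (c j')) -> fill_data dec c with
  | 0 => fun _ dec X c _ =>
      @FillData 0 Z J dec X c (fun z => c (dec z)) (fun z => eq_refl)
  | S m => fun H dec X c Hc =>
      let F := fill_aux (labelling_lt H) false (lo m) (Par_pick_parallel (bdry (c j0))) in
      @FillData (S m) Z J dec X c
        (@SGHom (gSetn m) (tr (S m) Z) X (fd_hom F) (fun z => c (dec z))
           (@fill_bdry m Z lo H J j0 dec X c Hc F))
        (fun z => eq_refl)
  end H dec X c Hc.

Definition fill (n : nat) (Z : gSet) (lo : forall k, Z k -> bool) (H : labelling n lo)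
  (J : Type) (j0 : J) (dec : Z n -> J) (X : gSetn n) (c : J -> gcell X)
  (Hc : forall j j', gparallel (c j) (c j')) : ghom (tr n Z) X :=
  fd_hom (fill_aux H j0 dec Hc).

Lemma fill_cell (n : nat) (Z : gSet) (lo : forall k, Z k -> bool) (H : labelling n lo)
  (J : Type) (j0 : J) (dec : Z n -> J) (X : gSetn n) (c : J -> gcell X)
  (Hc : forall j j', gparallel (c j) (c j')) (z : Z n) :
  gmap (fill H j0 dec Hc) (tcell z) = c (dec z).
Proof. exact: fd_cell. Qed.

Lemma fill_ext (n : nat) (Z : gSet) (lo : forall k, Z k -> bool) (H H' : labelling n lo)
  (J : Type) (j0 : J) (dec : Z n -> J) (X : gSetn n) (c c' : J -> gcell X)
  (Hc : forall j j', gparallel (c j) (c j')) (Hc' : forall j j', gparallel (c' j) (c' j')) :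
  (forall j, c j = c' j) -> fill H j0 dec Hc = fill H' j0 dec Hc'.
Proof.
move=> e; have {}e : c = c' by exact: functional_extensionality.
subst c'; by rewrite (proof_irrelevance _ H H') (proof_irrelevance _ Hc Hc').
Qed.

Lemma fill_map (n : nat) (Z : gSet) (lo : forall k, Z k -> bool) (H : labelling n lo)
  (J : Type) (j0 : J) (dec : Z n -> J) (X Y : gSetn n) (g : ghom X Y) (c : J -> gcell X)
  (Hc : forall j j', gparallel (c j) (c j'))
  (Hc' : forall j j', gparallel (gmap g (c j)) (gmap g (c j'))) :
  gcomp g (fill H j0 dec Hc) = fill H j0 dec (c := fun j => gmap g (c j)) Hc'.
Proof.
elim: n Z lo H J j0 dec X Y g c Hc Hc' => [|n IH] Z lo H J j0 dec X Y g c Hc Hc' //.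
apply: sghom_eq => [|x] //.
have Hp (b b' : bool) : gparallel (gmap (sgh_base g) (Par_pick (bdry (c j0)) b))
    (gmap (sgh_base g) (Par_pick (bdry (c j0)) b')).
  by apply: gmap_parallel; exact: Par_pick_parallel.
rewrite [LHS]/= (IH _ _ _ _ _ _ _ _ _ _ _ Hp).
apply: fill_ext => b; by case: b => /=; rewrite /bdry sgh_bdry.
Qed.

Fixpoint lowD (n k : nat) : Pos (D n) k -> bool :=
  match n, k return Pos (D n) k -> bool with
  | 0, _ => fun _ => false
  | S _, 0 => fun x => match x with None => false | Some _ => true end
  | S m, S j => fun x => match x with inl x' => lowD x' | inr _ => false end
  end.

Fixpoint lowQ (n k : nat) : Pos (Q n) k -> bool :=
  match n, k return Pos (Q n) k -> bool with
  | 0, _ => fun _ => false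
  | S _, 0 => fun x => match x with None => false | Some _ => true end
  | S m, S j => fun x => match x with inl x' => lowQ x' | inr _ => false end
  end.

Lemma lowD_labelling (m n : nat) : labelling n (@lowD m).
Proof.
move=> k x _; elim: m k x => [|m IH] [|k] //= [x|] //=; exact: IH.
Qed.

Lemma lowQ_labelling (n : nat) : labelling n (@lowQ n).
Proof.
elim: n => [|n IH] [|k] x Hk //=; first by inversion Hk.
- by inversion Hk.
- by case: x.
- by case: x => [x|[]]; apply: IH; exact: (proj2 (Nat.succ_lt_mono _ _)).
Qed.

Inductive side : Type := Lft | Mid | Rgt.

(** [sideQ] tells apart the three [n]-cells of [Q n], and [secondQ] its two [(n+1)]-cells. *)
Fixpoint sideQ (n : nat) : Pos (Q n) n -> side :=
  match n return Pos (Q n) n -> side with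
  | 0 => fun x => match x with None => Lft | Some None => Mid | Some (Some _) => Rgt end
  | S m => fun x => match x with inl x' => sideQ x' | inr _ => Lft end
  end.

Fixpoint secondQ (n : nat) : Pos (Q n) (S n) -> bool :=
  match n return Pos (Q n) (S n) -> bool with
  | 0 => fun x => match x with inl _ => false | inr _ => true end
  | S m => fun x => match x with inl x' => secondQ x' | inr _ => false end
  end.

Lemma sideQ_src (n : nat) (x : Pos (Q n) (S n)) :
  sideQ (src x) = if secondQ x then Mid else Lft.
Proof.
elim: n x => [|n IH] /=; first by case=> [x|[x|[]]] //=.
case=> [x|[]] /=; exact: IH.
Qed.

Lemma sideQ_tgt (n : nat) (x : Pos (Q n) (S n)) :
  sideQ (tgt x) = if secondQ x then Rgt else Mid.
Proof.
elim: n x => [|n IH] /=; first by case=> [x|[x|[]]] //=.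
case=> [x|[]] /=; exact: IH.
Qed.

Lemma secondQ_pcell (n : nat) : secondQ (pcell n) = false.
Proof. by elim: n. Qed.

Lemma secondQ_qcell (n : nat) : secondQ (qcell n) = true.
Proof. by elim: n. Qed.

Definition nclassify (n : nat) (X : gSetn (S n)) (c : gcell (sg_base X)) :
  ghom (tr (S n) (Pos (D n))) X.
Proof.
unshelve refine (@SGHom (gSetn n) (tr (S n) (Pos (D n))) X
  (fill (@lowD_labelling n n) tt (fun _ => tt) (c := fun _ => c) _) _ _).
- by move=> _ _; exact: gparallel_refl.
- by move=> x; case: (D_empty x).
- by move=> x; case: (D_empty x).
Defined.

Lemma nclassify_dcell (n : nat) (X : gSetn (S n)) (c : gcell (sg_base X)) :
  gmap (sgh_base (nclassify c)) (tcell (dcell n)) = c.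
Proof. exact: fill_cell. Qed.

Lemma nclassify_map (n : nat) (X Y : gSetn (S n)) (h : ghom X Y) (c : gcell (sg_base X)) :
  gcomp h (nclassify c) = nclassify (gmap (sgh_base h) c).
Proof.
apply: sghom_eq => [|x]; last by case: (D_empty x).
exact: fill_map.
Qed.

Section NClassify2.
Variables (n : nat) (X : gSetn (S n)) (a b : gcell X).
Hypothesis e : psnd (bdry a) = pfst (bdry b).

Definition side_cell (j : side) : gcell (sg_base X) :=
  match j with
  | Lft => pfst (bdry a)
  | Mid => psnd (bdry a)
  | Rgt => psnd (bdry b)
  end.

Lemma side_cell_parallel (j j' : side) : gparallel (side_cell j) (side_cell j').
Proof.
have H k : gparallel (side_cell Mid) (side_cell k).
  case: k => /=; [exact: (gparallel_sym (ppar _)) | exact: gparallel_refl |].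
  rewrite e; exact: ppar.
exact: gparallel_trans (gparallel_sym (H j)) (H j').
Qed.

Definition nclassify2 : ghom (tr (S n) (Pos (Q n))) X.
Proof.
unshelve refine (@SGHom (gSetn n) (tr (S n) (Pos (Q n))) X
  (fill (@lowQ_labelling n) Lft (@sideQ n) side_cell_parallel)
  (fun x => if secondQ x then b else a) _).
move=> x; apply: Par_eq.
- rewrite [RHS]/= [RHS](fill_cell _ _ _ _ (src x)) sideQ_src; by case: (secondQ x).
- rewrite [RHS]/= [RHS](fill_cell _ _ _ _ (tgt x)) sideQ_tgt; by case: (secondQ x).
Defined.

Lemma nclassify2_pcell : gmap nclassify2 (pcell n) = a.
Proof. by rewrite /= secondQ_pcell. Qed.

Lemma nclassify2_qcell : gmap nclassify2 (qcell n) = b.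
Proof. by rewrite /= secondQ_qcell. Qed.

End NClassify2.

Lemma nclassify2_map (n : nat) (X Y : gSetn (S n)) (h : ghom X Y) (a b : gcell X)
  (e : psnd (bdry a) = pfst (bdry b)) (e' : psnd (bdry (gmap h a)) = pfst (bdry (gmap h b))) :
  gcomp h (nclassify2 e) = nclassify2 e'.
Proof.
apply: sghom_eq => [|x] /=; last by case: (secondQ x).
have Hp (j j' : side) : gparallel (gmap (sgh_base h) (side_cell a b j))
    (gmap (sgh_base h) (side_cell a b j')).
  by apply: gmap_parallel; exact: side_cell_parallel.
rewrite (fill_map _ _ _ _ Hp).
apply: fill_ext => j.
by case: j; rewrite /side_cell /bdry /= sgh_bdry.
Qed.

Definition is_source (n : nat) (B : tree) (a : Pos B n) : Prop :=
  forall x : Pos B n, (exists y, sigma n B n y = x) <-> x = a.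

Definition is_target (n : nat) (B : tree) (a : Pos B n) : Prop :=
  forall x : Pos B n, (exists y, tau n B n y = x) <-> x = a.

Definition globe_like (B : tree) : Prop :=
  forall n (a : Pos B (S n)), is_source a \/ is_target a ->
    is_source (src a) /\ is_target (tgt a).

Lemma is_source0 (B : tree) : is_source (n := 0) (B := B) (bfirst (Pos B)).
Proof. move=> x; split=> [[[] <-] //|->]; by exists tt. Qed.

Lemma is_target0 (B : tree) : is_target (n := 0) (B := B) (blast (Pos B)).
Proof. move=> x; split=> [[[] <-] //|->]; by exists tt. Qed.

Lemma is_sourceS (n : nat) (B : tree) (a : Pos B n) :
  is_source (n := S n) (B := br [B]) (inl a) <-> is_source a.
Proof.
split=> H x.
- split=> [[y e]|->].
  + have /(_ (ex_intro _ (inl y) _)) := proj1 (H (inl x)); rewrite /= e => /(_ eq_refl).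
    by case.
  + have [y] := proj2 (H (inl a)) eq_refl.
    by case: y => [y|[]] /= [e]; exists y.
- split=> [[y e]|->].
  + case: y e => [y|[]] /= <-; congr inl; apply: (proj1 (H _)); by exists y.
  + have [y <-] := proj2 (H a) eq_refl; by exists (inl y).
Qed.

Lemma is_targetS (n : nat) (B : tree) (a : Pos B n) :
  is_target (n := S n) (B := br [B]) (inl a) <-> is_target a.
Proof.
split=> H x.
- split=> [[y e]|->].
  + have /(_ (ex_intro _ (inl y) _)) := proj1 (H (inl x)); rewrite /= e => /(_ eq_refl).
    by case.
  + have [y] := proj2 (H (inl a)) eq_refl.
    by case: y => [y|[]] /= [e]; exists y.
- split=> [[y e]|->].
  + case: y e => [y|[]] /= <-; congr inl; apply: (proj1 (H _)); by exists y.
  + have [y <-] := proj2 (H a) eq_refl; by exists (inl y).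
Qed.

Lemma globe_like_br (B : tree) : globe_like B -> globe_like (br [B]).
Proof.
move=> IH [|n] [a|[]] H.
- split; [exact: is_source0 | exact: is_target0].
- have [|Hs Ht] := IH n a.
    by case: H => H; [left; exact/is_sourceS | right; exact/is_targetS].
  by split; [exact/is_sourceS | exact/is_targetS].
Qed.

Lemma globe_like_D (n : nat) : globe_like (D n).
Proof.
elim: n => [|n IH]; last exact: globe_like_br.
by move=> n [].
Qed.

Lemma globe_like_Q (n : nat) : globe_like (Q n).
Proof.
elim: n => [|n IH]; last exact: globe_like_br.
move=> [|n] a H; last by move: a H => [[]|[[]|[]]].
case: H => H.
- have e1 := proj1 (H (pcell 0)) (ex_intro _ (pcell 0) eq_refl).
  have e2 := proj1 (H (qcell 0)) (ex_intro _ (qcell 0) eq_refl).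
  by move: e2; rewrite -e1.
- have e1 := proj1 (H (pcell 0)) (ex_intro _ (pcell 0) eq_refl).
  have e2 := proj1 (H (qcell 0)) (ex_intro _ (qcell 0) eq_refl).
  by move: e2; rewrite -e1.
Qed.

Lemma is_source_dcell (n : nat) : is_source (dcell n).
Proof. elim: n => [|n IH]; [exact (@is_source0 (D 0)) | exact/is_sourceS]. Qed.

Lemma is_target_dcell (n : nat) : is_target (dcell n).
Proof. elim: n => [|n IH]; [exact (@is_target0 (D 0)) | exact/is_targetS]. Qed.

Lemma is_source_pcell (n : nat) : is_source (src (pcell n)).
Proof. elim: n => [|n IH]; [exact (@is_source0 (Q 0)) | exact/is_sourceS]. Qed.

Lemma is_target_qcell (n : nat) : is_target (tgt (qcell n)).
Proof. elim: n => [|n IH]; [exact (@is_target0 (Q 0)) | exact/is_targetS]. Qed.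

(** The data carried along the recursion on [n]: the category of
   [n]-computads, the adjunction between [Cptd] and [Cell] (given by the unit
   [eta] and the transposition [transp]), the full spheres, the invertibility
   sets [Iset] with their three functions to cells, and, since these are needed to
   attach the generators of the next dimension, the boundaries [lunit_bdry] and
   [runit_bdry] of the cells [lunit i] and [runit i]. *)
Record iStage (n : nat) : Type := IStage {
  ob :> Type;
  hom : ob -> ob -> Type;
  hid : forall C, hom C C;
  hcomp : forall C D E, hom D E -> hom C D -> hom C E;
  hcomp_id_l : forall C D (f : hom C D), hcomp (hid D) f = f;
  hcomp_id_r : forall C D (f : hom C D), hcomp f (hid C) = f;
  hcomp_assoc : forall C D E F (h : hom E F) (g : hom D E) (f : hom C D),
    hcomp h (hcomp g f) = hcomp (hcomp h g) f;

  Cell : ob -> gSetn n;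
  Cell_map : forall C D, hom C D -> ghom (Cell C) (Cell D);
  Cell_map_id : forall C, Cell_map (hid C) = gid (Cell C);
  Cell_map_comp : forall C D E (g : hom D E) (f : hom C D),
    Cell_map (hcomp g f) = gcomp (Cell_map g) (Cell_map f);

  Cptd : gSetn n -> ob;
  eta : forall X : gSetn n, ghom X (Cell (Cptd X));
  transp : forall X C, ghom X (Cell C) -> hom (Cptd X) C;
  transp_eta : forall X C (h : ghom X (Cell C)), gcomp (Cell_map (transp h)) (eta X) = h;
  transp_unique : forall X C (f : hom (Cptd X) C), f = transp (gcomp (Cell_map f) (eta X));

  Full : forall B : tree, Par (Cell (Cptd (tr n (Pos B)))) -> Prop;
  Full_globe : forall B (a b : Pos B n) (e : parallel a b),
    globe_like B -> is_source a -> is_target b -> Full (Par_map (eta _) (tpar e));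

  Iset : ob -> Type;
  Iset_map : forall C D, hom C D -> Iset C -> Iset D;
  Iset_map_id : forall C (i : Iset C), Iset_map (hid C) i = i;
  Iset_map_comp : forall C D E (g : hom D E) (f : hom C D) (i : Iset C),
    Iset_map (hcomp g f) i = Iset_map g (Iset_map f i);
  fwd : forall C, Iset C -> gcell (Cell C);
  linv : forall C, Iset C -> gcell (Cell C);
  rinv : forall C, Iset C -> gcell (Cell C);
  fwd_map : forall C D (f : hom C D) (i : Iset C),
    gmap (Cell_map f) (fwd i) = fwd (Iset_map f i);
  linv_map : forall C D (f : hom C D) (i : Iset C),
    gmap (Cell_map f) (linv i) = linv (Iset_map f i);
  rinv_map : forall C D (f : hom C D) (i : Iset C),
    gmap (Cell_map f) (rinv i) = rinv (Iset_map f i);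

  lunit_bdry : forall C, Iset C -> Par (Cell C);
  runit_bdry : forall C, Iset C -> Par (Cell C);
  lunit_bdry_map : forall C D (f : hom C D) (i : Iset C),
    Par_map (Cell_map f) (lunit_bdry i) = lunit_bdry (Iset_map f i);
  runit_bdry_map : forall C D (f : hom C D) (i : Iset C),
    Par_map (Cell_map f) (runit_bdry i) = runit_bdry (Iset_map f i) }.

(** The action of a left adjoint on morphisms; [Cptd_map_succ] below spells it out. *)
Definition Cptd_map (n : nat) (L : iStage n) (X Y : gSetn n) (h : ghom X Y) :
  hom (Cptd L X) (Cptd L Y) := transp (gcomp (eta L Y) h).

Lemma transp_ext (n : nat) (L : iStage n) (X : gSetn n) (C : L) (f g : hom (Cptd L X) C) :
  gcomp (Cell_map f) (eta L X) = gcomp (Cell_map g) (eta L X) -> f = g.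
Proof. by rewrite {2}(transp_unique f) {2}(transp_unique g) => ->. Qed.

Lemma transp_comp (n : nat) (L : iStage n) (X : gSetn n) (C D : L)
  (f : hom C D) (h : ghom X (Cell C)) :
  hcomp f (transp h) = transp (gcomp (Cell_map f) h).
Proof. by apply: transp_ext; rewrite Cell_map_comp -gcomp_assoc !transp_eta. Qed.

Lemma Par_map_transp (n : nat) (L : iStage n) (X : gSetn n) (C : L)
  (h : ghom X (Cell C)) (p : Par X) :
  Par_map (Cell_map (transp h)) (Par_map (eta L X) p) = Par_map h p.
Proof. by rewrite -Par_map_comp transp_eta. Qed.

Lemma Cptd_map_eta (n : nat) (L : iStage n) (X Y : gSetn n) (h : ghom X Y) :
  gcomp (Cell_map (Cptd_map L h)) (eta L X) = gcomp (eta L Y) h.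
Proof. exact: transp_eta. Qed.

(** The recursion starts at 0: the terminal stage -1 carries no data. *)
Definition iStage0 : iStage 0.
Proof.
refine (@IStage 0
  Type (fun C D => C -> D) (fun _ x => x) (fun _ _ _ g f x => g (f x)) _ _ _
  (fun C => C : gSetn 0) (fun _ _ f => f) _ _
  (fun X => X) (fun _ x => x) (fun _ _ h => h) _ _
  (fun B A => pfst A = sigma 0 B 0 tt /\ psnd A = tau 0 B 0 tt) _
  (fun _ => Empty_set) (fun _ _ _ i => i) _ _
  (fun _ i => match i with end) (fun _ i => match i with end) (fun _ i => match i with end)
  _ _ _
  (fun _ i => match i with end) (fun _ i => match i with end) _ _).
all: try by [].
move=> B a b e _ Ha Hb; split.
- by apply/esym/(proj1 (Ha _)); exists tt.
- by apply/esym/(proj1 (Hb _)); exists tt.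
Defined.

Section Succ.
Variables (n : nat) (L : iStage n).

Record sob : Type := SOb {
  so_base : L;
  so_V : Type;
  so_U : Type;
  so_phi : so_V -> Par (Cell so_base);
  so_psi : so_U -> Par (Cell so_base) }.

Inductive sIset (C : sob) : Type :=
| igen (u : so_U C)
| lunit (i : Iset (so_base C))
| runit (i : Iset (so_base C)).

Arguments igen {C} u.
Arguments lunit {C} i.
Arguments runit {C} i.

Definition ibdry (C : sob) (i : sIset C) : Par (Cell (so_base C)) :=
  match i with
  | igen u => so_psi u
  | lunit i => lunit_bdry i
  | runit i => runit_bdry i
  end.

Definition sCptd (X : gSetn (S n)) : sob :=
  @SOb (Cptd L (sg_base X)) (gcell X) Empty_set
    (fun x => Par_map (eta L _) (bdry x)) (fun u => match u with end).

(** The inductive-recursive definition of cells together with their boundary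
   and of morphisms is encoded by raw cells, which carry a boundary but whose
   components of dimension [n+1] need not respect it, and a predicate [wf]
   singling out those that do. In [rcoh B A f fV], the pair [(f, fV)] is a
   prospective morphism to [C] from the computad of [Pos B], which has no
   invertible generators of dimension [n+1]. *)
Inductive raw (C : sob) : Type :=
| rgen (v : so_V C)
| rfwd (i : sIset C)
| rlinv (i : sIset C)
| rrinv (i : sIset C)
| rcoh (B : tree) (A : Par (Cell (Cptd L (tr n (Pos B)))))
    (f : hom (Cptd L (tr n (Pos B))) (so_base C)) (fV : Pos B (S n) -> raw C).

Arguments rcoh {C} B A f fV.

Definition raw_bdry (C : sob) (c : raw C) : Par (Cell (so_base C)) :=
  match c with
  | rgen v => so_phi v
  | rfwd i => ibdry i
  | rlinv i => Par_op (ibdry i)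
  | rrinv i => Par_op (ibdry i)
  | rcoh B A f fV => Par_map (Cell_map f) A
  end.

Fixpoint wf (C : sob) (c : raw C) : Prop :=
  match c with
  | rcoh B A f fV =>
      dim B <= S n /\ Full A /\
      forall x : Pos B (S n), wf (fV x) /\
        raw_bdry (fV x) = Par_map (Cell_map f) (so_phi (s := sCptd (tr (S n) (Pos B))) x)
  | _ => True
  end.

Record scell (C : sob) : Type := SCell { craw : raw C; cwf : wf craw }.

Lemma scell_eq (C : sob) (c d : scell C) : craw c = craw d -> c = d.
Proof.
case: c => [c Hc]; case: d => [d Hd] /= e; subst d.
by rewrite (proof_irrelevance _ Hc Hd).
Qed.

Definition scell_bdry (C : sob) (c : scell C) : Par (Cell (so_base C)) := raw_bdry (craw c).

Record shom (D C : sob) : Type := SHom {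
  sh_base : hom (so_base D) (so_base C);
  sh_V : so_V D -> scell C;
  sh_U : so_U D -> sIset C;
  sh_phi : forall v, scell_bdry (sh_V v) = Par_map (Cell_map sh_base) (so_phi v);
  sh_psi : forall u, ibdry (sh_U u) = Par_map (Cell_map sh_base) (so_psi u) }.

Lemma shom_eq (D C : sob) (f g : shom D C) :
  sh_base f = sh_base g -> (forall v, craw (sh_V f v) = craw (sh_V g v)) ->
  (forall u, sh_U f u = sh_U g u) -> f = g.
Proof.
case: f => [f0 fV fU f1 f2]; case: g => [g0 gV gU g1 g2] /= e eV eU; subst g0.
have {}eV : fV = gV by apply: functional_extensionality => v; apply: scell_eq.
have {}eU : fU = gU by apply: functional_extensionality.
subst gV gU; by rewrite (proof_irrelevance _ f1 g1) (proof_irrelevance _ f2 g2).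
Qed.

Definition gen (C : sob) (v : so_V C) : scell C := @SCell C (rgen v) I.
Definition sfwd (C : sob) (i : sIset C) : scell C := @SCell C (rfwd i) I.
Definition slinv (C : sob) (i : sIset C) : scell C := @SCell C (rlinv i) I.
Definition srinv (C : sob) (i : sIset C) : scell C := @SCell C (rrinv i) I.

Definition coh (C : sob) (B : tree) (HB : dim B <= S n)
  (A : Par (Cell (Cptd L (tr n (Pos B))))) (HA : Full A)
  (f : shom (sCptd (tr (S n) (Pos B))) C) : scell C :=
  @SCell C (@rcoh C B A (sh_base f) (fun x => craw (sh_V f x)))
    (conj HB (conj HA (fun x => conj (cwf (sh_V f x)) (sh_phi f x)))).

Definition sIset_map (D C : sob) (f : shom D C) (i : sIset D) : sIset C :=
  match i with
  | igen u => sh_U f u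
  | lunit i => lunit (Iset_map (sh_base f) i)
  | runit i => runit (Iset_map (sh_base f) i)
  end.

Lemma ibdry_map (D C : sob) (f : shom D C) (i : sIset D) :
  ibdry (sIset_map f i) = Par_map (Cell_map (sh_base f)) (ibdry i).
Proof. by case: i => [u|i|i] /=; rewrite ?sh_psi ?lunit_bdry_map ?runit_bdry_map. Qed.

Fixpoint raw_map (D C : sob) (f : shom D C) (c : raw D) : raw C :=
  match c with
  | rgen v => craw (sh_V f v)
  | rfwd i => rfwd (sIset_map f i)
  | rlinv i => rlinv (sIset_map f i)
  | rrinv i => rrinv (sIset_map f i)
  | rcoh B A g gV => @rcoh C B A (hcomp (sh_base f) g) (fun x => raw_map f (gV x))
  end.

Lemma raw_bdry_map (D C : sob) (f : shom D C) (c : raw D) :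
  raw_bdry (raw_map f c) = Par_map (Cell_map (sh_base f)) (raw_bdry c).
Proof.
case: c => [v|i|i|i|B A g gV] /=; rewrite ?ibdry_map ?Par_map_op //.
- exact: sh_phi.
- by rewrite Cell_map_comp Par_map_comp.
Qed.

Lemma wf_map (D C : sob) (f : shom D C) (c : raw D) : wf c -> wf (raw_map f c).
Proof.
elim: c => [v|i|i|i|B A g gV IH] //=; first by move=> _; exact: cwf.
move=> [HB [HA Hg]]; split=> //; split=> // x; have [Hx ex] := Hg x; split; first exact: IH.
by rewrite raw_bdry_map ex Cell_map_comp Par_map_comp.
Qed.

Definition scell_map (D C : sob) (f : shom D C) (c : scell D) : scell C :=
  SCell (wf_map f (cwf c)).

Definition sid (C : sob) : shom C C.
Proof.
refine (@SHom C C (hid _) (@gen C) (@igen C) _ _).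
all: abstract (by move=> v; rewrite Cell_map_id Par_map_id).
Defined.

Definition scomp (C D E : sob) (g : shom D E) (f : shom C D) : shom C E.
Proof.
refine (@SHom C E (hcomp (sh_base g) (sh_base f)) (fun v => scell_map g (sh_V f v))
  (fun u => sIset_map g (sh_U f u)) _ _).
- abstract (by move=> v; rewrite /scell_bdry raw_bdry_map Cell_map_comp Par_map_comp -sh_phi).
- abstract (by move=> u; rewrite ibdry_map Cell_map_comp Par_map_comp -sh_psi).
Defined.

Lemma sIset_map_id (C : sob) (i : sIset C) : sIset_map (sid C) i = i.
Proof. by case: i => [u|i|i] //=; rewrite Iset_map_id. Qed.

Lemma sIset_map_comp (C D E : sob) (g : shom D E) (f : shom C D) (i : sIset C) :
  sIset_map (scomp g f) i = sIset_map g (sIset_map f i).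
Proof. by case: i => [u|i|i] //=; rewrite Iset_map_comp. Qed.

Lemma raw_map_id (C : sob) (c : raw C) : raw_map (sid C) c = c.
Proof.
elim: c => [v|i|i|i|B A g gV IH] //=; rewrite ?sIset_map_id // hcomp_id_l.
by congr rcoh; apply: functional_extensionality.
Qed.

Lemma raw_map_comp (C D E : sob) (g : shom D E) (f : shom C D) (c : raw C) :
  raw_map (scomp g f) c = raw_map g (raw_map f c).
Proof.
elim: c => [v|i|i|i|B A h hV IH] //=; rewrite ?sIset_map_comp // -hcomp_assoc.
by congr rcoh; apply: functional_extensionality.
Qed.

Lemma scomp_id_l (C D : sob) (f : shom C D) : scomp (sid D) f = f.
Proof.
by apply: shom_eq => [|v|u] /=; rewrite ?hcomp_id_l ?raw_map_id ?sIset_map_id.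
Qed.

Lemma scomp_id_r (C D : sob) (f : shom C D) : scomp f (sid C) = f.
Proof. by apply: shom_eq => [|v|u] //=; rewrite hcomp_id_r. Qed.

Lemma scomp_assoc (C D E F : sob) (h : shom E F) (g : shom D E) (f : shom C D) :
  scomp h (scomp g f) = scomp (scomp h g) f.
Proof.
by apply: shom_eq => [|v|u] /=; rewrite ?hcomp_assoc ?raw_map_comp ?sIset_map_comp.
Qed.

Definition sCell (C : sob) : gSetn (S n) := @SGob (gSetn n) (Cell (so_base C)) (scell C) (@scell_bdry C).

Definition sCell_map (D C : sob) (f : shom D C) : ghom (sCell D) (sCell C) :=
  @SGHom (gSetn n) (sCell D) (sCell C) (Cell_map (sh_base f)) (scell_map f)
    (fun c => raw_bdry_map f (craw c)).

Lemma sCell_map_id (C : sob) : sCell_map (sid C) = gid (sCell C).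
Proof.
apply: sghom_eq => [|c] /=; first by rewrite Cell_map_id.
by apply: scell_eq; rewrite /= raw_map_id.
Qed.

Lemma sCell_map_comp (C D E : sob) (g : shom D E) (f : shom C D) :
  sCell_map (scomp g f) = gcomp (sCell_map g) (sCell_map f).
Proof.
apply: sghom_eq => [|c] /=; first by rewrite Cell_map_comp.
by apply: scell_eq; rewrite /= raw_map_comp.
Qed.

Definition seta (X : gSetn (S n)) : ghom X (sCell (sCptd X)) :=
  @SGHom (gSetn n) X (sCell (sCptd X)) (eta L _) (@gen (sCptd X)) (fun _ => eq_refl).

Definition stransp (X : gSetn (S n)) (C : sob) (h : ghom X (sCell C)) : shom (sCptd X) C.
Proof.
unshelve refine (@SHom (sCptd X) C (transp (sgh_base h)) (fun x => sgh_top h x)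
  (fun u : Empty_set => match u with end) _ _).
- abstract (by move=> x; rewrite [RHS]Par_map_transp -[RHS](sgh_bdry h)).
- by case.
Defined.

Lemma stransp_seta (X : gSetn (S n)) (C : sob) (h : ghom X (sCell C)) :
  gcomp (sCell_map (stransp h)) (seta X) = h.
Proof.
apply: sghom_eq => [|x] /=; first exact: transp_eta.
exact: scell_eq.
Qed.

Lemma stransp_unique (X : gSetn (S n)) (C : sob) (f : shom (sCptd X) C) :
  f = stransp (gcomp (sCell_map f) (seta X)).
Proof. by apply: shom_eq => [|v|[]] //=; exact: transp_unique. Qed.

Fixpoint supp (C : sob) (c : raw C) (g : so_V C + so_U C) : Prop :=
  match c with
  | rgen v => g = inl v
  | rfwd i | rlinv i | rrinv i =>
      match i with igen u => g = inr u | lunit _ | runit _ => False end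
  | rcoh B A f fV => exists p : Pos B (S n), supp (fV p) g
  end.

Definition sFull (B : tree) (A : Par (sCell (sCptd (tr (S n) (Pos B))))) : Prop :=
  (forall g, supp (craw (pfst A)) g <->
     exists y : Pos (bd (S n) B) (S n), g = inl (sigma (S n) B (S n) y)) /\
  (forall g, supp (craw (psnd A)) g <->
     exists y : Pos (bd (S n) B) (S n), g = inl (tau (S n) B (S n) y)) /\
  Full (scell_bdry (pfst A)).

Lemma sFull_globe (B : tree) (a b : Pos B (S n)) (e : parallel a b) :
  globe_like B -> is_source a -> is_target b -> sFull (Par_map (seta _) (tpar e)).
Proof.
move=> HB Ha Hb; split; [|split].
- move=> g; split=> [->|[y ->]] /=.
  + by have [y <-] := proj2 (Ha a) eq_refl; exists y.
  + by congr inl; apply: (proj1 (Ha _)); exists y.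
- move=> g; split=> [->|[y ->]] /=.
  + by have [y <-] := proj2 (Hb b) eq_refl; exists y.
  + by congr inl; apply: (proj1 (Hb _)); exists y.
- have [Hs Ht] := HB n a (or_introl Ha).
  exact: (Full_globe L (parallel_bdry a) HB Hs Ht).
Qed.

Lemma parallel_refl (X : gSet) (m : nat) (a : X m) : parallel a a.
Proof. by case: m a. Qed.

Lemma le_dim_D : dim (D n) <= S n.
Proof. rewrite dim_D; exact: Nat.le_succ_diag_r. Qed.

Lemma le_dim_Q : dim (Q n) <= S n.
Proof. by rewrite dim_Q. Qed.

Definition D_sphere : Par (Cell (Cptd L (tr n (Pos (D n))))) :=
  Par_map (eta L _) (tpar (parallel_refl (dcell n))).

Definition Q_sphere : Par (Cell (Cptd L (tr n (Pos (Q n))))) :=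
  Par_map (eta L _) (tpar (pq_parallel n)).

Lemma D_sphere_full : Full D_sphere.
Proof.
apply: Full_globe; [exact: globe_like_D | exact: is_source_dcell | exact: is_target_dcell].
Qed.

Lemma Q_sphere_full : Full Q_sphere.
Proof.
apply: Full_globe; [exact: globe_like_Q | exact: is_source_pcell | exact: is_target_qcell].
Qed.

Definition id_cell (C : sob) (c : gcell (Cell (so_base C))) : scell C :=
  coh le_dim_D D_sphere_full (stransp (nclassify (X := sCell C) c)).

Definition comp_cell (C : sob) (a b : scell C)
  (e : psnd (scell_bdry a) = pfst (scell_bdry b)) : scell C :=
  coh le_dim_Q Q_sphere_full (stransp (nclassify2 (X := sCell C) e)).

Arguments comp_cell {C} a b e.

Lemma id_cell_bdry (C : sob) (c : gcell (Cell (so_base C))) :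
  pfst (scell_bdry (id_cell c)) = c /\ psnd (scell_bdry (id_cell c)) = c.
Proof.
have -> : scell_bdry (id_cell c)
    = Par_map (sgh_base (nclassify (X := sCell C) c)) (tpar (parallel_refl (dcell n))).
  exact: Par_map_transp.
by split; exact: (@nclassify_dcell n (sCell C) c).
Qed.

Lemma comp_cell_bdry (C : sob) (a b : scell C)
  (e : psnd (scell_bdry a) = pfst (scell_bdry b)) :
  pfst (scell_bdry (comp_cell a b e)) = pfst (scell_bdry a) /\
  psnd (scell_bdry (comp_cell a b e)) = psnd (scell_bdry b).
Proof.
have -> : scell_bdry (comp_cell a b e)
    = Par_map (sgh_base (nclassify2 (X := sCell C) e)) (tpar (pq_parallel n)).
  exact: Par_map_transp.
have H x := f_equal (@pfst _ _) (sgh_bdry (nclassify2 (X := sCell C) e) x).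
have H' x := f_equal (@psnd _ _) (sgh_bdry (nclassify2 (X := sCell C) e) x).
split.
- have := H (pcell n); by rewrite /= secondQ_pcell => <-.
- have := H' (qcell n); by rewrite /= secondQ_qcell => <-.
Qed.

Lemma scell_map_coh (C C' : sob) (f : shom C C') (B : tree) (HB : dim B <= S n)
  (A : Par (Cell (Cptd L (tr n (Pos B))))) (HA : Full A)
  (g : shom (sCptd (tr (S n) (Pos B))) C) :
  scell_map f (coh HB HA g) = coh HB HA (scomp f g).
Proof. exact: scell_eq. Qed.

Lemma scomp_stransp (X : gSetn (S n)) (C C' : sob) (f : shom C C') (h : ghom X (sCell C)) :
  scomp f (stransp h) = stransp (gcomp (sCell_map f) h).
Proof. by apply: shom_eq => [|v|[]] //=; exact: transp_comp. Qed.

Lemma id_cell_map (C C' : sob) (f : shom C C') (c : gcell (Cell (so_base C))) :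
  scell_map f (id_cell c) = id_cell (gmap (Cell_map (sh_base f)) c).
Proof. by rewrite /id_cell scell_map_coh scomp_stransp nclassify_map. Qed.

Lemma comp_cell_map (C C' : sob) (f : shom C C') (a b : scell C)
  (e : psnd (scell_bdry a) = pfst (scell_bdry b))
  (e' : psnd (scell_bdry (scell_map f a)) = pfst (scell_bdry (scell_map f b))) :
  scell_map f (comp_cell a b e) = comp_cell _ _ e'.
Proof.
by rewrite /comp_cell scell_map_coh scomp_stransp (nclassify2_map (Y := sCell C') (h := sCell_map f) e e').
Qed.

Definition slunit_bdry (C : sob) (i : sIset C) : Par (sCell C).
Proof.
refine (@MkPar _ (sCell C)
  (comp_cell (slinv i) (sfwd i) eq_refl) (id_cell (psnd (scell_bdry (sfwd i)))) _).
abstract (by apply: Par_eq; rewrite ?(proj1 (id_cell_bdry _)) ?(proj2 (id_cell_bdry _))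
  ?(proj1 (comp_cell_bdry _)) ?(proj2 (comp_cell_bdry _))).
Defined.

Definition srunit_bdry (C : sob) (i : sIset C) : Par (sCell C).
Proof.
refine (@MkPar _ (sCell C)
  (comp_cell (sfwd i) (srinv i) eq_refl) (id_cell (pfst (scell_bdry (sfwd i)))) _).
abstract (by apply: Par_eq; rewrite ?(proj1 (id_cell_bdry _)) ?(proj2 (id_cell_bdry _))
  ?(proj1 (comp_cell_bdry _)) ?(proj2 (comp_cell_bdry _))).
Defined.

Lemma comp_cell_ext (C : sob) (a b a' b' : scell C)
  (e : psnd (scell_bdry a) = pfst (scell_bdry b))
  (e' : psnd (scell_bdry a') = pfst (scell_bdry b')) :
  a = a' -> b = b' -> comp_cell a b e = comp_cell a' b' e'.
Proof. by move=> ea eb; subst a' b'; rewrite (proof_irrelevance _ e e'). Qed.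

Lemma slunit_bdry_map (C D : sob) (f : shom C D) (i : sIset C) :
  Par_map (sCell_map f) (slunit_bdry i) = slunit_bdry (sIset_map f i).
Proof.
apply: Par_eq => /=.
- have e : psnd (scell_bdry (scell_map f (slinv i))) = pfst (scell_bdry (scell_map f (sfwd i))) by [].
  rewrite (comp_cell_map _ e); apply: comp_cell_ext; exact: scell_eq.
- by rewrite id_cell_map /scell_bdry /= ibdry_map.
Qed.

Lemma srunit_bdry_map (C D : sob) (f : shom C D) (i : sIset C) :
  Par_map (sCell_map f) (srunit_bdry i) = srunit_bdry (sIset_map f i).
Proof.
apply: Par_eq => /=.
- have e : psnd (scell_bdry (scell_map f (sfwd i))) = pfst (scell_bdry (scell_map f (srinv i))) by [].
  rewrite (comp_cell_map _ e); apply: comp_cell_ext; exact: scell_eq.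
- by rewrite id_cell_map /scell_bdry /= ibdry_map.
Qed.

Definition iStageS : iStage (S n).
Proof.
refine (@IStage (S n)
  sob shom sid scomp scomp_id_l scomp_id_r scomp_assoc
  sCell sCell_map sCell_map_id sCell_map_comp
  sCptd seta stransp stransp_seta stransp_unique
  sFull sFull_globe
  sIset sIset_map sIset_map_id sIset_map_comp
  sfwd slinv srinv _ _ _
  slunit_bdry srunit_bdry slunit_bdry_map srunit_bdry_map).
all: abstract (by move=> C D f i; exact: scell_eq).
Defined.

End Succ.

Arguments comp_cell {n L C} a b e.

Fixpoint iCompn (n : nat) : iStage n :=
  match n with
  | 0 => iStage0
  | S m => iStageS (iCompn m)
  end.

Lemma Cptd_map_succ (n : nat) (X Y : gSetn (S n)) (h : ghom X Y) :
  sh_base (Cptd_map (iCompn (S n)) h) = Cptd_map (iCompn n) (sgh_base h) /\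
  (forall x, sh_V (Cptd_map (iCompn (S n)) h) x = gen (C := sCptd (iCompn n) Y) (sgh_top h x)).
Proof. by split. Qed.

Definition itrunc (n : nat) (C : iCompn (S n)) : iCompn n := so_base C.

Record iComp : Type := IComp {
  lev :> forall n, iCompn n;
  lev_trunc : forall n, itrunc (lev (S n)) = lev n }.

Definition Par_cast (n : nat) (C D : iCompn n) (e : C = D) (p : Par (Cell C)) : Par (Cell D) :=
  match e in _ = D return Par (Cell D) with eq_refl => p end.

Definition hom_cast (n : nat) (C C' D D' : iCompn n) (e : C = C') (e' : D = D')
  (f : hom C D) : hom C' D' :=
  match e in _ = C', e' in _ = D' return hom C' D' with eq_refl, eq_refl => f end.

Definition ghom_cast (n : nat) (X : gSetn n) (C D : iCompn n) (e : C = D)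
  (f : ghom X (Cell C)) : ghom X (Cell D) :=
  match e in _ = D return ghom X (Cell D) with eq_refl => f end.

Record iHom (C D : iComp) : Type := IHom {
  lev_hom :> forall n, hom (C n) (D n);
  lev_hom_trunc : forall n,
    hom_cast (lev_trunc C n) (lev_trunc D n) (sh_base (lev_hom (S n))) = lev_hom n }.

Definition cell_bdry (C : iComp) (n : nat) (x : gcell (Cell (C (S n)))) : Par (Cell (C n)) :=
  Par_cast (lev_trunc C n) (bdry x).

Definition Cells (C : iComp) : gSet.
Proof.
refine (@GSet (fun n => gcell (Cell (C n)))
  (fun n x => pfst (cell_bdry x)) (fun n x => psnd (cell_bdry x)) _ _).
all: abstract (by move=> k x; rewrite /(cell_bdry (n := k)) /bdry
  (ppar (cell_bdry x) : sg_bdry _ = sg_bdry _)).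
Defined.

Lemma Par_cast_map (n : nat) (C C' D D' : iCompn n) (e : C = C') (e' : D = D')
  (f : hom C D) (p : Par (Cell C)) :
  Par_cast e' (Par_map (Cell_map f) p) = Par_map (Cell_map (hom_cast e e' f)) (Par_cast e p).
Proof. by destruct e, e'. Qed.

Lemma cell_bdry_map (C D : iComp) (f : iHom C D) (n : nat) (x : Cells C (S n)) :
  cell_bdry (gmap (Cell_map (f (S n))) x) = Par_map (Cell_map (f n)) (cell_bdry x).
Proof.
rewrite /cell_bdry -(lev_hom_trunc f n) -Par_cast_map; congr Par_cast.
exact: raw_bdry_map.
Qed.

Definition Cells_map (C D : iComp) (f : iHom C D) : gHom (Cells C) (Cells D).
Proof.
refine (@GHom (Cells C) (Cells D) (fun n x => gmap (Cell_map (f n)) x) _ _).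
all: abstract (by move=> k x; rewrite /= cell_bdry_map).
Defined.

Definition Comp (X : gSet) : iComp :=
  @IComp (fun n => Cptd (iCompn n) (tr n X)) (fun n => eq_refl).

Definition Comp_map (X Y : gSet) (h : gHom X Y) : iHom (Comp X) (Comp Y) :=
  @IHom (Comp X) (Comp Y) (fun n => Cptd_map (iCompn n) (trmap n h)) (fun n => eq_refl).

Definition Comp_unit (X : gSet) : gHom X (Cells (Comp X)).
Proof.
refine (@GHom X (Cells (Comp X)) (fun n x => gmap (eta (iCompn n) (tr n X)) (tcell x)) _ _).
all: abstract (by []).
Defined.

Record tr_Cells_data (C : iComp) (n : nat) : Type := TrCellsData {
  tc_hom : ghom (tr n (Cells C)) (Cell (C n));
  tc_cell : forall x : Cells C n, gmap tc_hom (tcell x) = x }.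

Lemma ghom_cast_pfst (n : nat) (X : gSetn n) (C D : iCompn n) (e : C = D)
  (p : Par (Cell C)) (f : ghom X (Cell D)) (u : gcell X) :
  gmap f u = pfst (Par_cast e p) -> pfst p = gmap (ghom_cast (eq_sym e) f) u.
Proof. by destruct e => /= ->. Qed.

Lemma ghom_cast_psnd (n : nat) (X : gSetn n) (C D : iCompn n) (e : C = D)
  (p : Par (Cell C)) (f : ghom X (Cell D)) (u : gcell X) :
  gmap f u = psnd (Par_cast e p) -> psnd p = gmap (ghom_cast (eq_sym e) f) u.
Proof. by destruct e => /= ->. Qed.

Lemma tr_Cells_bdry (C : iComp) (n : nat) (F : tr_Cells_data C n) (x : Cells C (S n)) :
  sg_bdry (s := Cell (C (S n))) x
  = Par_map (ghom_cast (eq_sym (lev_trunc C n)) (tc_hom F)) (sg_bdry (s := tr (S n) (Cells C)) x).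
Proof.
by apply: Par_eq; [apply: ghom_cast_pfst | apply: ghom_cast_psnd]; exact: (tc_cell F).
Qed.

Fixpoint tr_Cells_aux (C : iComp) (n : nat) : tr_Cells_data C n :=
  match n return tr_Cells_data C n with
  | 0 => @TrCellsData C 0 (fun x => x) (fun x => eq_refl)
  | S m =>
    let F := tr_Cells_aux C m in
    @TrCellsData C (S m)
      (@SGHom (gSetn m) (tr (S m) (Cells C)) (Cell (C (S m)))
         (ghom_cast (eq_sym (lev_trunc C m)) (tc_hom F)) (fun x => x) (tr_Cells_bdry F))
      (fun x => eq_refl)
  end.

Definition tr_Cells (C : iComp) (n : nat) : ghom (tr n (Cells C)) (Cell (C n)) :=
  tc_hom (tr_Cells_aux C n).

Lemma tr_Cells_cell (C : iComp) (n : nat) (x : Cells C n) : gmap (tr_Cells C n) (tcell x) = x.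
Proof. exact: tc_cell. Qed.

Lemma transp_cast (n : nat) (X : gSetn n) (C D : iCompn n) (e : C = D) (f : ghom X (Cell D)) :
  hom_cast eq_refl e (transp (ghom_cast (eq_sym e) f)) = transp f.
Proof. by destruct e. Qed.

Definition Comp_counit (C : iComp) : iHom (Comp (Cells C)) C :=
  @IHom (Comp (Cells C)) C (fun n => transp (tr_Cells C n))
    (fun n => transp_cast (lev_trunc C n) (tr_Cells C n)).

Lemma Cell_map_cast (n : nat) (X Y : gSetn n) (C C' D D' : iCompn n) (e : C = C') (e' : D = D')
  (f : hom C D) (h : ghom X (Cell C')) (k : ghom Y (Cell D')) (t : ghom X Y) :
  gcomp (Cell_map (hom_cast e e' f)) h = gcomp k t ->
  gcomp (Cell_map f) (ghom_cast (eq_sym e) h) = gcomp (ghom_cast (eq_sym e') k) t.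
Proof. by destruct e, e'. Qed.

Lemma tr_Cells_map (C D : iComp) (f : iHom C D) (n : nat) :
  gcomp (Cell_map (f n)) (tr_Cells C n) = gcomp (tr_Cells D n) (trmap n (Cells_map f)).
Proof.
elim: n => [|n IH] //.
apply: sghom_eq => //=; apply: Cell_map_cast.
by rewrite lev_hom_trunc.
Qed.

Definition T (X : gSet) : gSet := Cells (Comp X).

Definition T_map (X Y : gSet) (h : gHom X Y) : gHom (T X) (T Y) := Cells_map (Comp_map h).

Definition T_unit (X : gSet) : gHom X (T X) := Comp_unit X.

Definition T_mult (X : gSet) : gHom (T (T X)) (T X) := Cells_map (Comp_counit (Comp X)).

Record wCat : Type := WCat {
  wset :> gSet;
  wact : gHom (T wset) wset;
  wact_unit : forall n (x : wset n), wact n (T_unit wset n x) = x;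
  wact_mult : forall n (x : T (T wset) n), wact n (T_mult wset n x) = wact n (T_map wact n x) }.

Definition K (C : iComp) : wCat.
Proof.
refine (@WCat (Cells C) (Cells_map (Comp_counit C)) _ _).
- abstract (by move=> n x; rewrite [LHS]/= -gmap_comp transp_eta tr_Cells_cell).
- abstract (move=> n x; rewrite [LHS]/= [RHS]/= -!gmap_comp -!Cell_map_comp;
    congr (gmap (Cell_map _) x); apply: transp_ext;
    rewrite !Cell_map_comp -!gcomp_assoc Cptd_map_eta (transp_eta (tr_Cells (Comp (Cells C)) n))
      gcomp_assoc transp_eta;
    exact: (tr_Cells_map (Comp_counit C))).
Defined.

Section Operations.
Variable X : wCat.

Definition gen_cell (Y : gSet) (n : nat) (y : Y n) : T Y n := T_unit Y n y.

Definition wid (n : nat) (x : X n) : X (S n) :=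
  wact X (S n) (T_map (classify x) (S n)
    (id_cell (C := Comp (Pos (D n)) (S n)) (gen_cell (dcell n)))).

Lemma gen_pq_glue (n : nat) :
  psnd (scell_bdry (C := Comp (Pos (Q n)) (S n)) (gen_cell (pcell n)))
  = pfst (scell_bdry (C := Comp (Pos (Q n)) (S n)) (gen_cell (qcell n))).
Proof. exact: (f_equal (fun c => gen_cell c) (pq_glue n)). Qed.

(** Composites are written in diagrammatic order. *)
Definition wcomp (n : nat) (x y : X (S n)) (e : tgt x = src y) : X (S n) :=
  wact X (S n) (T_map (classify2 e) (S n)
    (comp_cell (C := Comp (Pos (Q n)) (S n)) (gen_cell (pcell n)) (gen_cell (qcell n))
       (gen_pq_glue n))).

Arguments wcomp {n} x y e.

CoInductive invertibility : forall n : nat, X (S n) -> Type :=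
| Invertibility (n : nat) (f : X (S n))
    (fl : X (S n)) (fl_src : src fl = tgt f) (fl_tgt : tgt fl = src f)
    (fr : X (S n)) (fr_src : tgt f = src fr) (fr_tgt : tgt fr = src f)
    (fL : X (S (S n))) (fL_src : src fL = wcomp fl f fl_tgt) (fL_tgt : tgt fL = wid (tgt f))
    (fR : X (S (S n))) (fR_src : src fR = wcomp f fr fr_src) (fR_tgt : tgt fR = wid (src f)) :
    invertibility fL -> invertibility fR -> invertibility f.

Definition invertible (n : nat) (f : X (S n)) : Prop := inhabited (invertibility f).

End Operations.

Arguments wcomp {X n} x y e.

(* Main.v *)
From Stdlib Require Import ssreflect.
Require Import Defs.

Set Implicit Arguments.
Unset Strict Implicit.
Unset Printing Implicit Defensive.

(** The inverses of [fwd i] are [linv i] and [rinv i], and the cells that cancel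
   them are [fwd (lunit i)] and [fwd (runit i)]. These are again forward cells of
   elements of the invertibility set, so the construction goes on corecursively. *)

(** [lev_trunc] is only a propositional equality between the truncation of [C (S n)] and [C n], so
    cells and invertibility elements must be transported along it. *)
Definition cell_cast (n : nat) (C D : iCompn n) (e : C = D) (x : gcell (Cell C)) :
  gcell (Cell D) := eq_rect C (fun C => gcell (Cell C)) x D e.

Definition Iset_cast (n : nat) (C D : iCompn n) (e : C = D) (i : Iset C) : Iset D :=
  eq_rect C (fun C => Iset C) i D e.

Lemma cell_castK (n : nat) (C D : iCompn n) (e : C = D) (x : gcell (Cell C)) :
  cell_cast (eq_sym e) (cell_cast e x) = x.
Proof. by destruct e. Qed.

Lemma pfst_Par_cast (n : nat) (C D : iCompn n) (e : C = D) (p : Par (Cell C)) :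
  pfst (Par_cast e p) = cell_cast e (pfst p).
Proof. by destruct e. Qed.

Lemma psnd_Par_cast (n : nat) (C D : iCompn n) (e : C = D) (p : Par (Cell C)) :
  psnd (Par_cast e p) = cell_cast e (psnd p).
Proof. by destruct e. Qed.

Lemma gmap_ghom_cast (n : nat) (X : gSetn n) (C D : iCompn n) (e : C = D)
  (f : ghom X (Cell C)) (x : gcell X) :
  gmap (ghom_cast e f) x = cell_cast e (gmap f x).
Proof. by destruct e. Qed.

Lemma lunit_bdry_cast (n : nat) (C D : iCompn n) (e : C = D) (i : Iset D) :
  Par_cast e (lunit_bdry (Iset_cast (eq_sym e) i)) = lunit_bdry i.
Proof. by destruct e. Qed.

Lemma runit_bdry_cast (n : nat) (C D : iCompn n) (e : C = D) (i : Iset D) :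
  Par_cast e (runit_bdry (Iset_cast (eq_sym e) i)) = runit_bdry i.
Proof. by destruct e. Qed.

Section Invertibility.
Variable C : iComp.

(** Naturality of the unit turns the generator on [z] into the one on [h z], which the counit sends
    back to the cell itself by the triangle identity. *)
Lemma act_map_gen (Z : gSet) (h : gHom Z (Cells C)) (n : nat) (z : Z n) :
  wact (K C) n (T_map h n (gen_cell z)) = h n z.
Proof.
rewrite /= -!gmap_comp -gcomp_assoc Cptd_map_eta gcomp_assoc transp_eta gmap_comp.
by rewrite trmap_cell tr_Cells_cell.
Qed.

(** Acting after [T_map] amounts to applying a single morphism of computads, and these preserve
    composites. [e'] is arbitrary, so the result can match the composites inside [lunit_bdry] and
    [runit_bdry]. *)
Lemma wcomp_K (n : nat) (x y : K C (S n)) (e : tgt x = src y)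
  (e' : psnd (scell_bdry (C := C (S n)) x) = pfst (scell_bdry (C := C (S n)) y)) :
  wcomp x y e = comp_cell (C := C (S n)) x y e'.
Proof.
have ex : wact (K C) (S n) (T_map (classify2 e) (S n) (gen_cell (pcell n))) = x.
  by rewrite act_map_gen classify2_pcell.
have ey : wact (K C) (S n) (T_map (classify2 e) (S n) (gen_cell (qcell n))) = y.
  by rewrite act_map_gen classify2_qcell.
(* This is the transpose of the classifying map: it sends the two top generators to [x] and [y]. *)
pose f : shom (Comp (Pos (Q n)) (S n)) (C (S n)) :=
  scomp (Comp_counit C (S n)) (Comp_map (classify2 e) (S n)).
have e2 : psnd (scell_bdry (scell_map f (gen_cell (pcell n))))
    = pfst (scell_bdry (scell_map f (gen_cell (qcell n)))).
  rewrite /scell_bdry !raw_bdry_map /=; congr (gmap _ _); exact: gen_pq_glue.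
have H := comp_cell_map (gen_pq_glue n) e2.
have Hf c : scell_map f c = wact (K C) (S n) (T_map (classify2 e) (S n) c).
  by apply: scell_eq; exact: raw_map_comp.
rewrite /wcomp -Hf H; apply: comp_cell_ext; by rewrite Hf.
Qed.

(** [id_cell] expects a cell of the truncation of [C (S n)], whence the backward transport of
    [x]. *)
Lemma wid_K (n : nat) (x : K C n) :
  wid x = id_cell (C := C (S n)) (cell_cast (eq_sym (lev_trunc C n)) x).
Proof.
rewrite /wid [LHS]/= !id_cell_map; congr id_cell.
(* Once [x] is written as an image of [dcell n], it remains to compare two globular morphisms, which
   agree by the triangle identity. *)
rewrite -[RHS](f_equal (cell_cast _) (tr_Cells_cell x)) -gmap_ghom_cast.
rewrite -[in RHS](classify_dcell x) -trmap_cell -!gmap_comp.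
congr (gmap _ _).
rewrite -gcomp_assoc (Cptd_map_eta (iCompn n)) gcomp_assoc transp_eta.
by [].
Qed.

(** The boundaries in [src_fwd] and [tgt_fwd] come transported in this way; the transport cancels
    the one in [wid_K]. *)
Lemma wid_cast (n : nat) (c : gcell (Cell (itrunc (C (S n))))) :
  wid (X := K C) (cell_cast (lev_trunc C n) c) = id_cell (C := C (S n)) c.
Proof. rewrite wid_K; congr id_cell; exact: cell_castK. Qed.

Lemma src_fwd (n : nat) (i : Iset (C (S n))) :
  src (g := K C) (fwd i) = cell_cast (lev_trunc C n) (pfst (ibdry i)).
Proof. exact: pfst_Par_cast. Qed.

Lemma tgt_fwd (n : nat) (i : Iset (C (S n))) :
  tgt (g := K C) (fwd i) = cell_cast (lev_trunc C n) (psnd (ibdry i)).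
Proof. exact: psnd_Par_cast. Qed.

Lemma src_linv (n : nat) (i : Iset (C (S n))) :
  src (g := K C) (linv i) = tgt (g := K C) (fwd i).
Proof. by rewrite tgt_fwd; exact: pfst_Par_cast. Qed.

Lemma tgt_linv (n : nat) (i : Iset (C (S n))) :
  tgt (g := K C) (linv i) = src (g := K C) (fwd i).
Proof. by rewrite src_fwd; exact: psnd_Par_cast. Qed.

Lemma src_rinv (n : nat) (i : Iset (C (S n))) :
  src (g := K C) (rinv i) = tgt (g := K C) (fwd i).
Proof. by rewrite tgt_fwd; exact: pfst_Par_cast. Qed.

Lemma tgt_rinv (n : nat) (i : Iset (C (S n))) :
  tgt (g := K C) (rinv i) = src (g := K C) (fwd i).
Proof. by rewrite src_fwd; exact: psnd_Par_cast. Qed.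

Definition Iset_prev (n : nat) (i : Iset (C n)) : Iset (so_base (C (S n))) :=
  Iset_cast (eq_sym (lev_trunc C n)) i.

Definition next_lunit (n : nat) (i : Iset (C n)) : Iset (C (S n)) := lunit (Iset_prev i).

Definition next_runit (n : nat) (i : Iset (C n)) : Iset (C (S n)) := runit (Iset_prev i).

(** The transport inside [next_lunit] is undone by the one inside [cell_bdry]. *)
Lemma cell_bdry_lunit (n : nat) (i : Iset (C n)) :
  cell_bdry (C := C) (fwd (next_lunit i)) = lunit_bdry i.
Proof. exact: lunit_bdry_cast. Qed.

Lemma cell_bdry_runit (n : nat) (i : Iset (C n)) :
  cell_bdry (C := C) (fwd (next_runit i)) = runit_bdry i.
Proof. exact: runit_bdry_cast. Qed.

(** The composite carries its glueing proof; [tgt_linv i] is the one that [fwd_invertibility]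
    supplies to the constructor. *)
Lemma src_fwd_lunit (n : nat) (i : Iset (C (S n))) :
  src (g := K C) (fwd (next_lunit i)) = wcomp (X := K C) (linv i) (fwd i) (tgt_linv i).
Proof.
rewrite wcomp_K; exact: (f_equal (@pfst _ _) (cell_bdry_lunit i)).
Qed.

Lemma tgt_fwd_lunit (n : nat) (i : Iset (C (S n))) :
  tgt (g := K C) (fwd (next_lunit i)) = wid (X := K C) (tgt (g := K C) (fwd i)).
Proof.
rewrite (tgt_fwd i) wid_cast; exact: (f_equal (@psnd _ _) (cell_bdry_lunit i)).
Qed.

Lemma src_fwd_runit (n : nat) (i : Iset (C (S n))) :
  src (g := K C) (fwd (next_runit i))
  = wcomp (X := K C) (fwd i) (rinv i) (eq_sym (src_rinv i)).
Proof.
rewrite wcomp_K; exact: (f_equal (@pfst _ _) (cell_bdry_runit i)).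
Qed.

Lemma tgt_fwd_runit (n : nat) (i : Iset (C (S n))) :
  tgt (g := K C) (fwd (next_runit i)) = wid (X := K C) (src (g := K C) (fwd i)).
Proof.
rewrite (src_fwd i) wid_cast; exact: (f_equal (@psnd _ _) (cell_bdry_runit i)).
Qed.

(** The dimension varies because both corecursive calls are one dimension higher; they are guarded,
    standing directly under the constructor. *)
CoFixpoint fwd_invertibility (n : nat) (i : Iset (C (S n))) :
  invertibility (X := K C) (n := n) (fwd i) :=
  @Invertibility (K C) n (fwd i)
    (linv i) (src_linv i) (tgt_linv i) (rinv i) (eq_sym (src_rinv i)) (tgt_rinv i)
    (fwd (next_lunit i)) (src_fwd_lunit i) (tgt_fwd_lunit i)
    (fwd (next_runit i)) (src_fwd_runit i) (tgt_fwd_runit i)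
    (fwd_invertibility (next_lunit i)) (fwd_invertibility (next_runit i)).

End Invertibility.

Theorem proposition4p10 (C : iComp) (n : nat) (i : Iset (C (S n))) :
  invertible (X := K C) (n := n) (fwd i).
Proof. exact: (inhabits (fwd_invertibility i)). Qed.
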